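(* Let $(A_r)_{r\ge 0}$ be a sequence of diagram algebras over an integral domain $R$ with field of fractions $\mathbb{F}$ (see context). Let $0\le s<r$, $\nu\in\widehat A_r$, $\lambda\in\widehat A_s$, and let $\mathsf t^\lambda$ be a maximal element of $\mathrm{Std}_s(\lambda)$ with respect to the dominance order on paths. Define the $R$-submodules of $\Delta_r(\nu)$ $$\Delta(\nu;\triangleright\lambda)=\mathrm{Span}_R\{m^\nu_{\mathsf t}:\mathsf t\in\mathrm{Std}_r(\nu),\ \mathsf t(s)\triangleright\lambda\},\qquad \Delta(\nu;\mathsf t^\lambda)=\mathrm{Span}_R\{m^\nu_{\mathsf t^\lambda\circ\mathsf t}:\mathsf t\in\mathrm{Std}_{s,r}(\nu\setminus\lambda)\}.$$ Then $\Delta(\nu;\triangleright\lambda)$ and $\Delta(\nu;\mathsf t^\lambda)+\Delta(\nu;\triangleright\lambda)$ are $A_r\cap A_s'$-submodules of $\Delta_r(\nu)$, where $A_r\cap A_s'$ is the algebra of elements of $A_r$ commuting with every element of $A_s$.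
   Context: **Cellular algebras.** A cellular algebra over $R$ is a unital $R$-algebra $A$ with an algebra involution $*$ ($R$-linear anti-automorphism, $(x^* )^*=x$), a finite poset $(\widehat A,\trianglerighteq)$, a finite index set $T(\lambda)$ for each $\lambda\in\widehat A$, and an $R$-basis $\{c^\lambda_{st}:\lambda\in\widehat A,\ s,t\in T(\lambda)\}$ such that, with $A^{\triangleright\lambda}$ (resp. $A^{\trianglerighteq\lambda}$) the span of the $c^\mu_{st}$ with $\mu\triangleright\lambda$ (resp. $\mu\trianglerighteq\lambda$): (a) for $t\in T(\lambda)$, $a\in A$ there are $r(a;t,v)\in R$ with $c^\lambda_{st}a\equiv\sum_v r(a;t,v)c^\lambda_{sv}$ mod $A^{\triangleright\lambda}$ for all $s$; (b) $(c^\lambda_{st})^*\equiv c^\lambda_{ts}$ mod $A^{\triangleright\lambda}$. The cell module $\Delta(\lambda)$ is the right $A$-module, free over $R$ on $\{c^\lambda_t\}$, with $c^\lambda_t a=\sum_v r(a;t,v)c^\lambda_v$. There is an $A$-$A$-bimodule isomorphism $\alpha_\lambda:A^{\trianglerighteq\lambda}/A^{\triangleright\lambda}\to\Delta(\lambda)^*\otimes_R\Delta(\lambda)$, $c^\lambda_{st}+A^{\triangleright\lambda}\mapsto (c^\lambda_s)^*\otimes c^\lambda_t$, where $M^*$ is the left module obtained from a right module $M$ via $*$. $A$ is cyclic cellular if every cell module is cyclic. A cell filtration of a right module is a finite filtration $0=M_0\subseteq\dots\subseteq M_p$ with $M_i/M_{i-1}\cong\Delta(\lambda^{(i)})$; it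 is order preserving if $\lambda^{(i)}\triangleright\lambda^{(i+1)}$ for all $i$. **Sequence of diagram algebras.** $(A_r)_{r\ge0}$ is an increasing sequence of cellular algebras over $R$, with unital inclusions and compatible involutions; $\widehat A_r$ is the poset of $A_r$, $\Delta_r(\lambda)$ its cell modules, $A_r^{\mathbb F}=A_r\otimes_R\mathbb F$. For each $\lambda\in\widehat A_r$ a generator $\delta_r(\lambda)$ of $\Delta_r(\lambda)$ and an element $m_\lambda\in A_r^{\trianglerighteq\lambda}$ with $\alpha_\lambda(m_\lambda+A_r^{\triangleright\lambda})=\delta_r(\lambda)^*\otimes\delta_r(\lambda)$ are fixed; $\Delta_r(\lambda)$ is identified with $(m_\lambda A_r+A_r^{\triangleright\lambda})/A_r^{\triangleright\lambda}$ via $\delta_r(\lambda)a\leftrightarrow m_\lambda a+A_r^{\triangleright\lambda}$. Axioms: (D1) $A_0=R$ ($\widehat A_0=\{\varnothing\}$, $\Delta_0(\varnothing)=R$, $m_\varnothing=1$); (D2) each $A_r$ is cyclic cellular; (D3) $m_\lambda=m_\lambda^*$; (D4) each $A_r^{\mathbb F}$ is split semisimple; (D5) (restriction coherence) for each $\mu\in\widehat A_{r+1}$ the restriction of $\Delta_{r+1}(\mu)$ to $A_r$ has an order preserving cell filtration; (D6) below. **Branching diagram, branching factors.** $\widehat A$ is the graded directed graph with vertex set $\widehat A_r$ at level $r$ and an edge $\lambda\to\mu$ ($\lambda\in\widehat A_{r-1}$, $\mu\in\widehat A_r$) iff $\Delta_{r-1}(\lambda)$ is a subquotient in the order preserving cell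 filtration of the restriction of $\Delta_r(\mu)$ to $A_{r-1}$. Fixing such a filtration $(M_j)$ with isomorphisms $M_j/M_{j-1}\cong\Delta_{r-1}(\lambda_j)$, the branching factor $d_{\lambda_j\to\mu}\in A_r$ is a chosen element with $\delta_r(\mu)d_{\lambda_j\to\mu}\in M_j$ whose class in $M_j/M_{j-1}$ corresponds to $\delta_{r-1}(\lambda_j)$. (D6): there are elements $u_{\mu\to\lambda}\in A_{r+1}$ for each edge $\mu\to\lambda$ ($\mu\in\widehat A_r,\lambda\in\widehat A_{r+1}$) with $m_\lambda d_{\mu\to\lambda}=(u_{\mu\to\lambda})^*m_\mu$. **Paths, Murphy basis, dominance order.** For $\lambda\in\widehat A_s$, $\nu\in\widehat A_r$, $s\le r$, $\mathrm{Std}_{s,r}(\nu\setminus\lambda)$ is the set of directed paths $\mathsf t=(\lambda=\mathsf t(s)\to\mathsf t(s+1)\to\dots\to\mathsf t(r)=\nu)$; $\mathrm{Std}_r(\nu)=\mathrm{Std}_{0,r}(\nu\setminus\varnothing)$; $\mathsf s\circ\mathsf t$ is concatenation of paths. For $\mathsf t\in\mathrm{Std}_r(\nu)$, $d_{\mathsf t}=d_{\mathsf t(r-1)\to\mathsf t(r)}\cdots d_{\mathsf t(0)\to\mathsf t(1)}$. The Murphy basis $m^\nu_{\mathsf t}=m_\nu d_{\mathsf t}+A_r^{\triangleright\nu}$, $\mathsf t\in\mathrm{Std}_r(\nu)$, is known to be an $R$-basis of $\Delta_r(\nu)$. For paths, $\mathsf s\trianglerighteq\mathsf t$ iff $\mathsf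 s(j)\trianglerighteq\mathsf t(j)$ for all levels $j$. *)

(* Defs.v *)
From HB Require Import structures.
From mathcomp Require Import all_boot all_order all_algebra.

Set Implicit Arguments.
Unset Strict Implicit.
Unset Printing Implicit Defensive.

Import Order.TTheory GRing.Theory.
Local Open Scope ring_scope.

Definition lin_span (R : nzRingType) (M : lmodType R) (P : M -> Prop) (x : M) :
    Prop :=
  exists (n : nat) (k : 'I_n -> R) (v : 'I_n -> M),
    (forall i, P (v i)) /\ x = \sum_i k i *: v i.

Definition addsub (R : nzRingType) (M : lmodType R) (P Q : M -> Prop) (x : M) :
    Prop :=
  exists y z, [/\ P y, Q z & x = y + z].

(* [act] is a right action of A on M, and B is a subset of A. *)
Definition submodule (R : nzRingType) (A : Type) (M : lmodType R)
    (act : M -> A -> M) (B : A -> Prop) (P : M -> Prop) : Prop :=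
  [/\ P 0,
      forall x y, P x -> P y -> P (x + y),
      forall (k : R) x, P x -> P (k *: x)
    & forall x a, B a -> P x -> P (act x a)].

Definition cell_index (hat : finType) (T : hat -> finType) : finType :=
  {l : hat & (T l * T l)%type}.

Definition cell_idx (hat : finType) (T : hat -> finType) (l : hat) (s t : T l) :
    cell_index T :=
  Tagged (fun l => (T l * T l)%type) (s, t).

(* The order "mu |> l" is written [(l < mu)%O].  The structure constants r(a; t, v)
   and the coordinates are determined by the other data. *)
Record cellular (R : idomainType) (A : algType R) := Cellular {
  star : {linear A -> A};
  starM : forall a b, star (a * b) = star b * star a;
  starK : involutive star;
  hat_disp : Order.disp_t;
  hat : finPOrderType hat_disp;
  tab : hat -> finType;
  (* [cbasis (cell_idx s t)] is c^l_{st}. *)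
  cbasis : cell_index tab -> A;
  cell_coord : A -> cell_index tab -> R;
  cell_coordK : forall a, a = \sum_i cell_coord a i *: cbasis i;
  cell_coord_comb : forall (x : cell_index tab -> R) i,
    cell_coord (\sum_j x j *: cbasis j) i = x i;
  cell_gt := fun l : hat =>
    lin_span (fun a : A => exists (mu : hat) (s t : tab mu),
                         (l < mu)%O /\ a = cbasis (cell_idx s t));
  rcoef : forall l : hat, A -> tab l -> tab l -> R;
  cell_mul : forall (l : hat) (t : tab l) (a : A) (s : tab l),
    cell_gt l (cbasis (cell_idx s t) * a
               - \sum_v rcoef a t v *: cbasis (cell_idx s v));
  cell_star : forall (l : hat) (s t : tab l),
    cell_gt l (star (cbasis (cell_idx s t)) - cbasis (cell_idx t s))
}.

Arguments cell_coord {R A} c a i.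

Section CellModules.
Variables (R : idomainType) (A : algType R) (C : cellular A).

Definition cell_ge (l : hat C) : A -> Prop :=
  lin_span (fun a : A => exists (mu : hat C) (s t : tab mu),
                       (l <= mu)%O /\ a = cbasis (cell_idx s t)).

(* Free on the c^l_t; the function x stands for \sum_t (x t) c^l_t. *)
Definition cell_module (l : hat C) : lmodType R := {ffun tab l -> R^o}.

Definition cell_act (l : hat C) (x : cell_module l) (a : A) : cell_module l :=
  [ffun v => \sum_t x t * rcoef a t v].

Definition cell_generator (l : hat C) (x : cell_module l) : Prop :=
  forall y, exists a, y = cell_act x a.

(* [cell_rep x y] represents the class alpha_l^-1 (x^* (x) y) in
   A^{|>= l} / A^{|> l}. *)
Definition cell_rep (l : hat C) (x y : cell_module l) : A :=
  \sum_s \sum_t (x s * y t) *: cbasis (cell_idx s t).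

Lemma cell_gt0 (l : hat C) : cell_gt l 0.
Proof.
exists 0, (fun _ => 0), (fun _ => 0); split; first by case.
by rewrite big_ord0.
Qed.

Lemma cell_gtD (l : hat C) a b : cell_gt l a -> cell_gt l b -> cell_gt l (a + b).
Proof.
move=> [n [k [v [Pv ->]]]] [n' [k' [v' [Pv' ->]]]].
exists (n + n')%N, (fun i => match split i with inl j => k j | inr j => k' j end),
  (fun i => match split i with inl j => v j | inr j => v' j end).
split=> [i|]; first by case: split => j.
rewrite big_split_ord; congr (_ + _); apply: eq_bigr => i _.
  by rewrite -[lshift _ _]/(unsplit (inl i)) unsplitK.
by rewrite -[rshift _ _]/(unsplit (inr i)) unsplitK.
Qed.

Lemma cell_gtZ (l : hat C) k a : cell_gt l a -> cell_gt l (k *: a).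
Proof.
move=> [n [k' [v [Pv ->]]]]; exists n, (fun i => k * k' i), v; split=> //.
by rewrite scaler_sumr; apply: eq_bigr => i _; rewrite scalerA.
Qed.

Lemma cell_gt_sum (l : hat C) (I : finType) (f : I -> A) :
  (forall i, cell_gt l (f i)) -> cell_gt l (\sum_i f i).
Proof.
by move=> Pf; elim/big_ind: _ => //; [exact: cell_gt0 | exact: cell_gtD].
Qed.

Lemma cell_gt_mul (l : hat C) a b : cell_gt l a -> cell_gt l (a * b).
Proof.
move=> [n [k [v [Pv ->]]]]; rewrite mulr_suml; apply: cell_gt_sum => i.
rewrite -scalerAl; apply: cell_gtZ; have [mu [s [t [lt_l ->]]]] := Pv i.
rewrite -[X in cell_gt _ X](subrK (\sum_w rcoef b t w *: cbasis (cell_idx s w))).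
apply: cell_gtD.
  have [n' [k' [v' [Pv' ->]]]] := cell_mul t b s.
  exists n', k', v'; split=> // j; have [mu' [s' [t' [lt_mu ->]]]] := Pv' j.
  by exists mu', s', t'; split=> //; apply: lt_trans lt_mu.
apply: cell_gt_sum => w; apply: cell_gtZ.
exists 1%N, (fun _ => 1), (fun _ => cbasis (cell_idx s w)); split.
  by move=> _; exists mu, s, w.
by rewrite big_ord1 scale1r.
Qed.

(* The identification of x a with m a + A^{|> l} when m represents
   alpha_l^-1 (x^* (x) x). *)
Lemma cell_rep_act (l : hat C) (x : cell_module l) (m a : A) :
  cell_gt l (m - cell_rep x x) ->
  cell_gt l (m * a - cell_rep x (cell_act x a)).
Proof.
move=> mx; have -> : m * a - cell_rep x (cell_act x a) =
  (m - cell_rep x x) * a + (cell_rep x x * a - cell_rep x (cell_act x a)).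
  by rewrite mulrBl addrA subrK.
apply: cell_gtD; first exact: cell_gt_mul.
have -> : cell_rep x x * a - cell_rep x (cell_act x a) =
  \sum_s \sum_t (x s * x t) *: (cbasis (cell_idx s t) * a
               - \sum_v rcoef a t v *: cbasis (cell_idx s v)).
  rewrite /cell_rep mulr_suml -sumrB; apply: eq_bigr => s _.
  rewrite mulr_suml; under [RHS]eq_bigr do rewrite scalerBr.
  rewrite sumrB; congr (_ - _).
    by apply: eq_bigr => t _; rewrite scalerAl.
  under [RHS]eq_bigr do rewrite scaler_sumr.
  rewrite exchange_big /=; apply: eq_bigr => v _.
  rewrite ffunE mulr_sumr scaler_suml; apply: eq_bigr => t _.
  by rewrite scalerA mulrA.
apply: cell_gt_sum => s; apply: cell_gt_sum => t.
by apply: cell_gtZ; apply: cell_mul.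
Qed.

End CellModules.

(* A (x) F in the F-basis c_i (x) 1. *)
Definition scalar_ext (R : idomainType) (A : algType R) (C : cellular A) : Type :=
  {ffun cell_index (@tab _ _ C) -> {fraction R}^o}.

HB.instance Definition _ (R : idomainType) (A : algType R) (C : cellular A) :=
  GRing.Lmodule.copy (scalar_ext C)
    {ffun cell_index (@tab _ _ C) -> {fraction R}^o}.

Local Notation "x %:F" := (@FracField.tofrac _ x).

Section ScalarExt.
Variables (R : idomainType) (A : algType R) (C : cellular A).
Local Notation AF := (scalar_ext C).
Local Notation F := {fraction R}.

(* The map a |-> a (x) 1. *)
Definition ext_in (a : A) : AF := [ffun i => (cell_coord C a i)%:F].

Definition ext_mul (x y : AF) : AF :=
  \sum_i \sum_j (x i * y j) *: ext_in (cbasis i * cbasis j).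

Lemma cell_coord_lin k a b i : cell_coord C (k *: a + b) i = k * cell_coord C a i + cell_coord C b i.
Proof.
rewrite {1}(cell_coordK C a) {1}(cell_coordK C b) scaler_sumr -big_split /=.
under eq_bigr do rewrite scalerA -scalerDl.
by rewrite cell_coord_comb.
Qed.

Lemma ext_in_lin k a b : ext_in (k *: a + b) = k%:F *: ext_in a + ext_in b.
Proof. by apply/ffunP=> i; rewrite !ffunE cell_coord_lin rmorphD rmorphM. Qed.

Lemma ext_in0 : ext_in 0 = 0.
Proof.
have := ext_in_lin 1 0 0; rewrite scaler0 addr0 tofrac1 scale1r.
by move/eqP; rewrite -subr_eq subrr eq_sym => /eqP.
Qed.

Lemma ext_in_sum (I : finType) (k : I -> R) (f : I -> A) :
  ext_in (\sum_i k i *: f i) = \sum_i (k i)%:F *: ext_in (f i).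
Proof.
elim/big_rec2: _ => [|i x y _ <-]; first exact: ext_in0.
exact: ext_in_lin.
Qed.

Lemma ext_mulDl : left_distributive ext_mul +%R.
Proof.
move=> x y z; rewrite /ext_mul -big_split; apply: eq_bigr => i _ /=.
rewrite -big_split; apply: eq_bigr => j _ /=.
by rewrite ffunE mulrDl scalerDl.
Qed.

Lemma ext_mulDr : right_distributive ext_mul +%R.
Proof.
move=> x y z; rewrite /ext_mul -big_split; apply: eq_bigr => i _ /=.
rewrite -big_split; apply: eq_bigr => j _ /=.
by rewrite ffunE mulrDr scalerDl.
Qed.

Lemma ext_scaleAl (k : F) (x y : AF) : k *: ext_mul x y = ext_mul (k *: x) y.
Proof.
rewrite /ext_mul scaler_sumr; apply: eq_bigr => i _.
rewrite scaler_sumr; apply: eq_bigr => j _.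
by rewrite scalerA ffunE mulrA.
Qed.

Lemma ext_scaleAr (k : F) (x y : AF) : k *: ext_mul x y = ext_mul x (k *: y).
Proof.
rewrite /ext_mul scaler_sumr; apply: eq_bigr => i _.
rewrite scaler_sumr; apply: eq_bigr => j _.
by rewrite scalerA ffunE mulrCA.
Qed.

Lemma ext_inM a b : ext_in (a * b) = ext_mul (ext_in a) (ext_in b).
Proof.
rewrite {1}(cell_coordK C a) mulr_suml.
under eq_bigr do rewrite -scalerAl.
rewrite ext_in_sum; apply: eq_bigr => i _.
rewrite {1}(cell_coordK C b) mulr_sumr.
under eq_bigr do rewrite -scalerAr.
rewrite ext_in_sum scaler_sumr; apply: eq_bigr => j _.
by rewrite scalerA !ffunE.
Qed.

Lemma ext_in_basis i j : ext_in (cbasis i) j = (i == j)%:R.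
Proof.
rewrite ffunE.
have -> : cbasis i = \sum_l (i == l)%:R *: cbasis l :> A.
  rewrite (bigD1 i) //= eqxx scale1r big1 ?addr0 // => l.
  by rewrite eq_sym => /negPf->; rewrite scale0r.
by rewrite cell_coord_comb rmorph_nat.
Qed.

Lemma ext_decomp (x : AF) : x = \sum_i x i *: ext_in (cbasis i).
Proof.
apply/ffunP=> j; rewrite sum_ffunE (bigD1 j) //= big1 => [|i ne_ij].
  by rewrite addr0 ffunE ext_in_basis eqxx [_ *: _]mulr1.
by rewrite ffunE ext_in_basis (negPf ne_ij) [_ *: _]mulr0.
Qed.

Lemma ext_ind (P : AF -> Prop) :
  (forall x y, P x -> P y -> P (x + y)) -> (forall k x, P x -> P (k *: x)) ->
  (forall a, P (ext_in a)) -> forall x, P x.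
Proof.
move=> PD PZ Pin x; rewrite (ext_decomp x); elim/big_ind: _ => //.
- by rewrite -ext_in0.
by move=> i _; apply: PZ.
Qed.

Lemma ext_mulA : associative ext_mul.
Proof.
move=> x y z; elim/ext_ind: x => [x x' IH IH'|k x IH|a].
- by rewrite !ext_mulDl IH IH'.
- by rewrite -!ext_scaleAl IH.
elim/ext_ind: y => [y y' IH IH'|k y IH|b].
- by rewrite ext_mulDr !ext_mulDl ext_mulDr IH IH'.
- by rewrite -ext_scaleAr -!ext_scaleAl -ext_scaleAr IH.
elim/ext_ind: z => [z z' IH IH'|k z IH|c].
- by rewrite !ext_mulDr IH IH'.
- by rewrite -!ext_scaleAr IH.
by rewrite -!ext_inM mulrA.
Qed.

Lemma ext_mul1l : left_id (ext_in 1) ext_mul.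
Proof.
move=> x; elim/ext_ind: x => [x x' IH IH'|k x IH|a].
- by rewrite ext_mulDr IH IH'.
- by rewrite -ext_scaleAr IH.
by rewrite -ext_inM mul1r.
Qed.

Lemma ext_mul1r : right_id (ext_in 1) ext_mul.
Proof.
move=> x; elim/ext_ind: x => [x x' IH IH'|k x IH|a].
- by rewrite ext_mulDl IH IH'.
- by rewrite -ext_scaleAl IH.
by rewrite -ext_inM mulr1.
Qed.

Lemma ext_1_neq0 : ext_in 1 != 0.
Proof.
apply/eqP=> /ffunP in10; have /eqP[] := oner_neq0 A.
rewrite (cell_coordK C 1) big1 // => i _; have := in10 i.
by rewrite !ffunE => /eqP; rewrite tofrac_eq0 => /eqP->; rewrite scale0r.
Qed.

HB.instance Definition _ := GRing.Zmodule_isNzRing.Build AF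
  ext_mulA ext_mul1l ext_mul1r ext_mulDl ext_mulDr ext_1_neq0.
HB.instance Definition _ := GRing.Lmodule_isLalgebra.Build F AF ext_scaleAl.
HB.instance Definition _ := GRing.Lalgebra_isAlgebra.Build F AF ext_scaleAr.

End ScalarExt.

(* The phi_i are the components of an isomorphism from B onto a finite direct
   product of full matrix algebras over F. *)
Definition split_semisimple (F : fieldType) (B : algType F) : Prop :=
  exists (k : nat) (n : 'I_k -> nat)
         (phi : forall i, {lrmorphism B -> 'M[F]_((n i).+1)}),
    forall M : forall i, 'M[F]_((n i).+1), exists! x : B, forall i, phi i x = M i.

(* N is a right module with action [act].  The isomorphism from M_{i+1} / M_i
   to Delta(shape i) is given as a surjective A-linear map from M_{i+1} with
   kernel M_i; the values of [fproj i] outside M_{i+1} are irrelevant. *)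
Record cell_filtration (R : idomainType) (A : algType R) (C : cellular A)
    (N : lmodType R) (act : N -> A -> N) := CellFiltration {
  flen : nat;
  fshape : 'I_flen -> hat C;
  fsub : nat -> N -> Prop;
  fproj : forall i : 'I_flen, N -> cell_module (fshape i);
  fsub0 : forall x, fsub 0 x <-> x = 0;
  fsub_len : forall x, fsub flen x;
  fsub_submod : forall i, (i <= flen)%N -> submodule act (fun _ => True) (fsub i);
  fsub_le : forall (i : 'I_flen) x, fsub i x -> fsub i.+1 x;
  fproj_lin : forall (i : 'I_flen) k x y, fsub i.+1 x -> fsub i.+1 y ->
    fproj i (k *: x + y) = k *: fproj i x + fproj i y;
  fproj_act : forall (i : 'I_flen) x a, fsub i.+1 x ->
    fproj i (act x a) = cell_act (fproj i x) a;
  fproj_ker : forall (i : 'I_flen) x, fsub i.+1 x -> (fproj i x = 0 <-> fsub i x);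
  fproj_surj : forall (i : 'I_flen) z, exists2 x, fsub i.+1 x & fproj i x = z
}.

Definition order_preserving (R : idomainType) (A : algType R) (C : cellular A)
    (N : lmodType R) (act : N -> A -> N) (f : cell_filtration C act) : Prop :=
  forall i j : 'I_(flen f), j = i.+1 :> nat -> (fshape j < fshape i)%O.

Record diagram_algebras (R : idomainType) := DiagramAlgebras {
  dalg : nat -> algType R;
  dcell : forall r, cellular (dalg r);
  dincl : forall r, {lrmorphism dalg r -> dalg r.+1};
  dincl_inj : forall r, injective (dincl r);
  dincl_star : forall r a, dincl r (star (dcell r) a) = star (dcell r.+1) (dincl r a);
  dgen : forall r (l : hat (dcell r)), cell_module l;
  dm : forall r (l : hat (dcell r)), dalg r;
  dm_ge : forall r (l : hat (dcell r)), cell_ge l (dm l);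
  dm_gen : forall r (l : hat (dcell r)),
    cell_gt l (dm l - cell_rep (dgen l) (dgen l));
  (* A_0 = R, with one cell module, of rank one. *)
  dempty : hat (dcell 0);
  dempty_uniq : forall l : hat (dcell 0), l = dempty;
  dtab0 : #|tab dempty| = 1%N;
  dalg0 : forall a : dalg 0, exists k : R, a = k%:A;
  dm_empty : dm dempty = 1;
  dgen_cyclic : forall r (l : hat (dcell r)), cell_generator (dgen l);
  dm_star : forall r (l : hat (dcell r)), star (dcell r) (dm l) = dm l;
  dsplit : forall r, split_semisimple (scalar_ext (dcell r));
  dfilt : forall r (mu : hat (dcell r.+1)),
    cell_filtration (dcell r)
      (fun (x : cell_module mu) (a : dalg r) => cell_act x (dincl r a));
  dfilt_order : forall r (mu : hat (dcell r.+1)), order_preserving (dfilt mu);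
  dedge := fun r (l : hat (dcell r)) (mu : hat (dcell r.+1)) =>
    [exists i : 'I_(flen (dfilt mu)), fshape i == l];
  (* Branching factors; [dbranch l mu] is irrelevant if there is no edge from l
     to mu, and similarly for [du]. *)
  dbranch : forall r (l : hat (dcell r)) (mu : hat (dcell r.+1)), dalg r.+1;
  dbranch_sub : forall r (mu : hat (dcell r.+1)) (i : 'I_(flen (dfilt mu))),
    fsub (dfilt mu) i.+1 (cell_act (dgen mu) (dbranch (fshape i) mu));
  dbranch_proj : forall r (mu : hat (dcell r.+1)) (i : 'I_(flen (dfilt mu))),
    fproj i (cell_act (dgen mu) (dbranch (fshape i) mu)) = dgen (fshape i);
  du : forall r (mu : hat (dcell r)) (l : hat (dcell r.+1)), dalg r.+1;
  du_eq : forall r (mu : hat (dcell r)) (l : hat (dcell r.+1)), dedge mu l ->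
    dm l * dbranch mu l = star (dcell r.+1) (du mu l) * dincl r (dm mu)
}.

Section Paths.
Variables (R : idomainType) (D : diagram_algebras R).

Definition vertex (r : nat) := hat (dcell D r).

(* A path from level s to level r is represented by a function choosing a vertex
   at every level, of which only the values at levels s, ..., r are relevant.
   Every path arises in this way, as every [vertex j] is inhabited. *)
Definition path_fun := forall j : nat, vertex j.

Definition is_Std (s r : nat) (l : vertex s) (nu : vertex r) (t : path_fun) :
    Prop :=
  [/\ t s = l, t r = nu
    & forall j, (s <= j < r)%N -> dedge (t j) (t j.+1)].

Definition is_Std0 (r : nat) (nu : vertex r) : path_fun -> Prop :=
  is_Std (dempty D) nu.

Definition path_comp (s : nat) (t u : path_fun) : path_fun :=
  fun j => if (j <= s)%N then t j else u j.

(* [path_dom r t u]: u dominates t, for paths from level 0 to level r. *)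
Definition path_dom (r : nat) (t u : path_fun) : Prop :=
  forall j, (j <= r)%N -> (t j <= u j)%O.

Definition maximal_Std0 (s : nat) (l : vertex s) (t : path_fun) : Prop :=
  is_Std0 l t /\
  forall u, is_Std0 l u -> path_dom s t u -> forall j, (j <= s)%N -> u j = t j.

Fixpoint dpath (t : path_fun) (r : nat) : dalg D r :=
  match r with
  | 0 => 1
  | r'.+1 => dbranch (t r') (t r'.+1) * dincl D r' (dpath t r')
  end.

(* m_nu d_t + A_r^{|> nu}, which is identified with delta_r(nu) d_t. *)
Definition murphy (r : nat) (nu : vertex r) (t : path_fun) : cell_module nu :=
  cell_act (dgen nu) (dpath t r).

Lemma murphy_rep (r : nat) (nu : vertex r) (t : path_fun) :
  cell_gt nu (dm nu * dpath t r - cell_rep (dgen nu) (murphy nu t)).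
Proof. by apply: cell_rep_act; apply: dm_gen. Qed.

Definition Delta_gt (s r : nat) (nu : vertex r) (l : vertex s) :
    cell_module nu -> Prop :=
  lin_span (fun x => exists t, [/\ is_Std0 nu t, (l < t s)%O & x = murphy nu t]).

Definition Delta_path (s r : nat) (nu : vertex r) (l : vertex s)
    (tl : path_fun) : cell_module nu -> Prop :=
  lin_span (fun x => exists t, is_Std l nu t /\ x = murphy nu (path_comp s tl t)).

(* [from_level s a]: a lies in the image of A_s. *)
Inductive from_level (s : nat) : forall r, dalg D r -> Prop :=
| from_level_refl (a : dalg D s) : from_level s a
| from_level_incl r (a : dalg D r) : from_level s a -> from_level s (dincl D r a).

Definition rel_commutant (s r : nat) (a : dalg D r) : Prop :=
  forall b : dalg D r, from_level s b -> a * b = b * a.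

End Paths.

Arguments Delta_gt {R D s r} nu l x.
Arguments Delta_path {R D s r} nu l tl x.
Arguments rel_commutant {R} D s r a.

(* Main.v *)
Require Import Defs.
From HB Require Import structures.
From mathcomp Require Import all_boot all_order all_algebra.

(** Over the field of fractions F, the algebra A_s is split semisimple, so the
    ideal J_U spanned by the cells of an up-set U of vertices at level s has an
    identity element e_U.  It acts as the identity on the cell modules of U, and
    as 0 on the others, because they are killed by J_U.  The point is that
      Delta(nu; U) := span of the m_t with t(s) in U
    is, over F, the image of e_U on Delta_r(nu).  One inclusion comes from the
    identity m_lambda d = u^* m_mu: iterated along the part of t above level s,
    it writes m_nu d_t as w (m_{t(s)} d_{t'}), where t' is the part of t below
    level s, and the second factor lies in the right ideal J_U when t(s) is in U
    ([murphy_act_unit]).  The other one is an induction along the restriction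
    filtrations ([act_unit_span]).  As e_U lies in A_s, its image is stable under
    all that commutes with A_s ([commutant_span]); U = {mu > lambda} gives the
    first claim.

    For the second claim, U = {mu >= lambda} gives a stable submodule which,
    modulo Delta(nu; > lambda), is a direct sum of copies of Delta_s(lambda)
    indexed by the paths from lambda to nu.  That e_U acts as the identity on
    Delta_s(lambda) forces the bilinear form of the cell to be nondegenerate
    over F, so that A_s acts on Delta_s(lambda) by all endomorphisms
    ([cell_act_dense]).  Some f in A_s thus acts as a projection onto the line
    of m_{t^lambda}; the submodule of the claim consists of the vectors fixed by
    f modulo Delta(nu; > lambda), and f too commutes with the commutant
    ([gt_or_tl_stable]).

    To stay over R, e_U and f are multiplied by a common denominator k, and k is
    cancelled at the end: spans of subsets of a basis are saturated
    ([span_paths_saturated]).  This rests on the m_t being a basis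
    ([murphy_basis]), by induction on the level: a basis of each subquotient of
    a filtration lifts to a basis of the module, and the branching factors are
    such lifts of the cell generators. *)

Set Implicit Arguments.
Unset Strict Implicit.
Unset Printing Implicit Defensive.

Import Order.TTheory GRing.Theory.
Local Open Scope ring_scope.

(** * Spans, bases and saturation *)

Section Spans.
Variables (R : nzRingType) (M : lmodType R).
Implicit Types (P Q : M -> Prop) (x y : M).

Definition subspace Q : Prop :=
  [/\ Q 0, forall x y, Q x -> Q y -> Q (x + y)
    & forall (k : R) x, Q x -> Q (k *: x)].

Lemma subspaceB Q x y : subspace Q -> Q x -> Q y -> Q (x - y).
Proof. by case=> _ QD QZ Qx Qy; rewrite -scaleN1r; apply: QD (QZ _ _ _). Qed.

Lemma subspace_sum Q (I : finType) (P : pred I) (f : I -> M) :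
  subspace Q -> (forall i, P i -> Q (f i)) -> Q (\sum_(i | P i) f i).
Proof. by case=> Q0 QD _ Qf; apply: big_ind. Qed.

Lemma lin_span_incl P x : P x -> lin_span P x.
Proof.
by move=> Px; exists 1%N, (fun=> 1), (fun=> x); rewrite big_ord1 scale1r.
Qed.

Lemma lin_span_subspace P : subspace (lin_span P).
Proof.
split=> [|x y [n [k [v [Pv ->]]]] [n' [k' [v' [Pv' ->]]]]|c x [n [k [v [Pv ->]]]]].
- by exists 0, (fun=> 0), (fun=> 0); rewrite big_ord0; split=> // -[].
- exists (n + n')%N,
    (fun i => match split i with inl j => k j | inr j => k' j end),
    (fun i => match split i with inl j => v j | inr j => v' j end).
  split=> [i|]; first by case: split => j.
  rewrite big_split_ord; congr (_ + _); apply: eq_bigr => i _.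
    by rewrite -[lshift _ _]/(unsplit (inl i)) unsplitK.
  by rewrite -[rshift _ _]/(unsplit (inr i)) unsplitK.
exists n, (fun i => c * k i), v; split=> //.
by rewrite scaler_sumr; apply: eq_bigr => i _; rewrite scalerA.
Qed.

Lemma lin_span_min P Q : subspace Q -> (forall x, P x -> Q x) ->
  forall x, lin_span P x -> Q x.
Proof.
move=> subQ PQ x [n [k [v [Pv ->]]]]; apply: subspace_sum => // i _.
by case: subQ => _ _; apply; apply: PQ.
Qed.

Definition is_basis (I : finType) (b : I -> M) : Prop :=
  (forall x, exists k : {ffun I -> R}, x = \sum_i k i *: b i) /\
  (forall k : {ffun I -> R}, \sum_i k i *: b i = 0 -> forall i, k i = 0).

Lemma lin_span_family (I : finType) (b : I -> M) x :
  lin_span (fun y => exists i, y = b i) x ->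
  exists k : {ffun I -> R}, x = \sum_i k i *: b i.
Proof.
move: x; apply: lin_span_min => [|_ [i ->]]; last first.
  exists [ffun j => (j == i)%:R]; rewrite (bigD1 i) //= ffunE eqxx scale1r.
  by rewrite big1 ?addr0 // => j /negPf ne; rewrite ffunE ne scale0r.
split=> [|_ _ [k ->] [k' ->]|c _ [k ->]].
- by exists [ffun=> 0]; rewrite big1 // => i _; rewrite ffunE scale0r.
- exists [ffun i => k i + k' i]; rewrite -big_split; apply: eq_bigr => i _ /=.
  by rewrite ffunE scalerDl.
exists [ffun i => c * k i]; rewrite scaler_sumr; apply: eq_bigr => i _.
by rewrite ffunE scalerA.
Qed.

Section BasisCoord.
Variables (I : finType) (b : I -> M).
Hypothesis bP : is_basis b.

Lemma basis_coord_exists x : exists k : {ffun I -> R}, x == \sum_i k i *: b i.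
Proof. by have [k ->] := bP.1 x; exists k. Qed.

Definition basis_coord x : {ffun I -> R} := xchoose (basis_coord_exists x).

Lemma basis_coordK x : x = \sum_i basis_coord x i *: b i.
Proof. exact/eqP/(xchooseP (basis_coord_exists x)). Qed.

Lemma basis_coord_sum (k : I -> R) i : basis_coord (\sum_j k j *: b j) i = k i.
Proof.
set x := \sum_j _; have := bP.2 [ffun j => basis_coord x j - k j].
have -> : \sum_j [ffun j => basis_coord x j - k j] j *: b j = 0.
  under eq_bigr do rewrite ffunE scalerBl.
  by rewrite sumrB -basis_coordK subrr.
by move=> /(_ erefl i); rewrite ffunE => /subr0_eq.
Qed.

Lemma basis_coord_lin k x y i :
  basis_coord (k *: x + y) i = k * basis_coord x i + basis_coord y i.
Proof.
rewrite {1}(basis_coordK x) {1}(basis_coordK y) scaler_sumr -big_split /=.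
by under eq_bigr do rewrite scalerA -scalerDl; rewrite basis_coord_sum.
Qed.

Lemma basis_coordZ k x i : basis_coord (k *: x) i = k * basis_coord x i.
Proof.
rewrite {1}(basis_coordK x) scaler_sumr.
by under eq_bigr do rewrite scalerA; rewrite basis_coord_sum.
Qed.

Lemma basis_coord_basis i j : basis_coord (b i) j = (j == i)%:R.
Proof.
have -> : b i = \sum_l (l == i)%:R *: b l.
  rewrite (bigD1 i) //= eqxx scale1r big1 ?addr0 // => l /negPf->.
  by rewrite scale0r.
by rewrite basis_coord_sum.
Qed.

Lemma lin_span_subbasis (P : pred I) x :
  lin_span (fun y => exists2 i, P i & y = b i) x <->
  forall i, ~~ P i -> basis_coord x i = 0.
Proof.
split=> [|x0].
  move: x; apply: lin_span_min => [|_ [i Pi ->] j nPj]; last first.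
    rewrite basis_coord_basis (_ : j == i = false) //.
    by apply: contraNF nPj => /eqP->.
  split=> [i _|x y x0 y0 i nPi|k x x0 i nPi].
  - by rewrite -(scale0r (0 : M)) basis_coordZ mul0r.
  - by rewrite -[x]scale1r basis_coord_lin x0 // y0 // mulr0 addr0.
  by rewrite basis_coordZ x0 // mulr0.
have [span0 _ spanZ] := lin_span_subspace (fun y => exists2 i, P i & y = b i).
rewrite (basis_coordK x); apply: subspace_sum => [|i _].
  exact: lin_span_subspace.
have [Pi|nPi] := boolP (P i); first by apply/spanZ/lin_span_incl; exists i.
by rewrite x0 // scale0r.
Qed.

End BasisCoord.
End Spans.

(** Cancels the denominators introduced by working over the field of fractions. *)
Lemma lin_span_subbasis_saturated (R : idomainType) (M : lmodType R) (I : finType)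
    (b : I -> M) (P : pred I) (k : R) (x : M) :
  is_basis b -> k != 0 ->
  lin_span (fun y => exists2 i, P i & y = b i) (k *: x) ->
  lin_span (fun y => exists2 i, P i & y = b i) x.
Proof.
move=> bP k0 /(lin_span_subbasis bP) kx0; apply/(lin_span_subbasis bP) => i nPi.
by have /eqP := kx0 i nPi; rewrite basis_coordZ mulf_eq0 (negPf k0) => /eqP.
Qed.

(** * Cell ideals and the action on cell modules *)

Section Ideals.
Variables (R : idomainType) (A : algType R) (C : cellular A).
Implicit Types (a b : A) (l mu : hat C) (U V : pred (hat C)).

Definition up_closed U : Prop := forall l mu, (l <= mu)%O -> U l -> U mu.

(** The span of the cells with index in [U], described by coordinates; for
    the up-sets [mu > l] and [mu >= l] these are [cell_gt] and [cell_ge]. *)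
Definition in_ideal U a : Prop :=
  forall i, ~~ U (tag i) -> cell_coord C a i = 0.

Lemma cell_coordD a b i :
  cell_coord C (a + b) i = cell_coord C a i + cell_coord C b i.
Proof. by rewrite -[a]scale1r cell_coord_lin mul1r scale1r. Qed.

Lemma cell_coord0 i : cell_coord C 0 i = 0.
Proof. by have /eqP := cell_coordD 0 0 i; rewrite addr0 -subr_eq subrr => /eqP. Qed.

Lemma cell_coordZ k a i : cell_coord C (k *: a) i = k * cell_coord C a i.
Proof. by rewrite -[k *: a]addr0 cell_coord_lin cell_coord0 addr0. Qed.

Lemma cell_coord_sum (I : finType) (f : I -> A) i :
  cell_coord C (\sum_j f j) i = \sum_j cell_coord C (f j) i.
Proof.
by elim/big_rec2: _ => [|j x y _ <-]; rewrite ?cell_coord0 ?cell_coordD.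
Qed.

Lemma cell_coord_basis i j : cell_coord C (cbasis i) j = (i == j)%:R.
Proof.
have -> : cbasis i = \sum_l (i == l)%:R *: cbasis l :> A.
  rewrite (bigD1 i) //= eqxx scale1r big1 ?addr0 // => l.
  by rewrite eq_sym => /negPf->; rewrite scale0r.
by rewrite cell_coord_comb.
Qed.

Lemma cell_idx_eq l (s t u v : tab l) :
  (cell_idx s t == cell_idx u v) = (s == u) && (t == v).
Proof. by rewrite eq_Tagged. Qed.

Lemma in_ideal_subspace U : subspace (in_ideal U).
Proof.
split=> [i|a b a0 b0 i|k a a0 i] nUi; first exact: cell_coord0.
  by rewrite cell_coordD a0 // b0 // addr0.
by rewrite cell_coordZ a0 // mulr0.
Qed.

Lemma in_ideal_basis U i : U (tag i) -> in_ideal U (cbasis i).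
Proof.
move=> Ui j nUj; rewrite cell_coord_basis (_ : i == j = false) //.
by apply: contraNF nUj => /eqP <-.
Qed.

Lemma cell_gt_in_ideal l a : cell_gt l a -> in_ideal (fun mu => l < mu)%O a.
Proof.
move: a; apply: lin_span_min; first exact: in_ideal_subspace.
by move=> _ [mu [s [t [lt ->]]]]; apply: in_ideal_basis.
Qed.

Lemma cell_ge_in_ideal l a : cell_ge l a -> in_ideal (fun mu => l <= mu)%O a.
Proof.
move: a; apply: lin_span_min; first exact: in_ideal_subspace.
by move=> _ [mu [s [t [lt ->]]]]; apply: in_ideal_basis.
Qed.

Lemma in_ideal_sub U V a : (forall l, U l -> V l) -> in_ideal U a -> in_ideal V a.
Proof. by move=> UV Ua i nVi; apply: Ua; apply: contra nVi; apply: UV. Qed.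

Lemma cell_gt_above U l a : up_closed U -> U l -> cell_gt l a -> in_ideal U a.
Proof.
move=> upU Ul /cell_gt_in_ideal; apply: in_ideal_sub => mu /ltW le.
exact: upU le Ul.
Qed.

Lemma cell_gt_coord0 l a (i : cell_index (@tab _ _ C)) :
  tag i = l -> cell_gt l a -> cell_coord C a i = 0.
Proof. by move=> il /cell_gt_in_ideal; apply; rewrite il ltxx. Qed.

Lemma in_ideal_span U (Q : A -> Prop) : subspace Q ->
  (forall l (s t : tab l), U l -> Q (cbasis (cell_idx s t))) ->
  forall a, in_ideal U a -> Q a.
Proof.
move=> subQ Qb a Ua; have [Q0 _ QZ] := subQ.
rewrite (cell_coordK C a); apply: subspace_sum => // -[l [s t]] _.
have [Ul|nUl] := boolP (U l); first exact/QZ/Qb.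
by rewrite Ua // scale0r.
Qed.

Lemma in_ideal_mulr U a b : up_closed U -> in_ideal U a -> in_ideal U (a * b).
Proof.
move=> upU; have [J0 JD JZ] := in_ideal_subspace U.
move: a; apply: in_ideal_span => [|l s t Ul].
  split=> [|x y|k x]; first by rewrite mul0r.
    by rewrite mulrDl; apply: JD.
  by rewrite -scalerAl; apply: JZ.
rewrite -[_ * b](subrK (\sum_v rcoef b t v *: cbasis (cell_idx s v))).
apply: JD; first exact: cell_gt_above (cell_mul _ _ _).
apply: subspace_sum => [|v _]; first exact: in_ideal_subspace.
by apply/JZ/in_ideal_basis.
Qed.

(** The involution exchanges left and right multiplication, so it is what makes
    the right ideal [in_ideal U] two-sided. *)
Lemma in_ideal_star U a : up_closed U -> in_ideal U a -> in_ideal U (star C a).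
Proof.
move=> upU; have [J0 JD JZ] := in_ideal_subspace U.
move: a; apply: in_ideal_span => [|l s t Ul].
  split=> [|x y|k x]; first by rewrite linear0.
    by rewrite linearD; apply: JD.
  by rewrite linearZ; apply: JZ.
rewrite -[star C _](subrK (cbasis (cell_idx t s))).
by apply: JD; [exact: cell_gt_above (cell_star _ _) | exact: in_ideal_basis].
Qed.

Lemma in_ideal_mull U a b : up_closed U -> in_ideal U b -> in_ideal U (a * b).
Proof.
move=> upU Ub; rewrite -[a * b](@starK _ _ C) starM.
by apply/in_ideal_star/in_ideal_mulr/in_ideal_star.
Qed.

Lemma rcoefE l (s t v : tab l) a :
  rcoef a t v = cell_coord C (cbasis (cell_idx s t) * a) (cell_idx s v).
Proof.
rewrite -[_ * a](subrK (\sum_w rcoef a t w *: cbasis (cell_idx s w))) cell_coordD.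
rewrite (cell_gt_coord0 _ (cell_mul _ _ _)) // add0r cell_coord_sum (bigD1 v) //=.
rewrite cell_coordZ cell_coord_basis eqxx mulr1 big1 ?addr0 // => w /negPf ne.
by rewrite cell_coordZ cell_coord_basis cell_idx_eq ne andbF mulr0.
Qed.

Lemma rcoef_lin l (t v : tab l) k a b :
  rcoef (k *: a + b) t v = k * rcoef a t v + rcoef b t v.
Proof. by rewrite !(rcoefE t) mulrDr -scalerAr cell_coord_lin. Qed.

Lemma rcoef_sum l (t v : tab l) (I : finType) (k : I -> R) (f : I -> A) :
  rcoef (\sum_i k i *: f i) t v = \sum_i k i * rcoef (f i) t v.
Proof.
rewrite (rcoefE t) mulr_sumr cell_coord_sum; apply: eq_bigr => i _.
by rewrite -scalerAr cell_coordZ -rcoefE.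
Qed.

Lemma rcoefM l (t w : tab l) a b :
  rcoef (a * b) t w = \sum_v rcoef a t v * rcoef b v w.
Proof.
rewrite (rcoefE t) mulrA.
rewrite -[cbasis _ * a](subrK (\sum_v rcoef a t v *: cbasis (cell_idx t v))).
rewrite mulrDl cell_coordD (@cell_gt_coord0 l) ?add0r //; last first.
  exact/cell_gt_mul/cell_mul.
rewrite mulr_suml cell_coord_sum; apply: eq_bigr => v _.
by rewrite -scalerAl cell_coordZ -rcoefE.
Qed.

Lemma rcoef1 l (t v : tab l) : rcoef (1 : A) t v = (t == v)%:R.
Proof. by rewrite (rcoefE t) mulr1 cell_coord_basis cell_idx_eq eqxx. Qed.

Lemma cell_act_linr l (x : cell_module l) k a b :
  cell_act x (k *: a + b) = k *: cell_act x a + cell_act x b.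
Proof.
apply/ffunP=> v; rewrite !ffunE -[_ *: (\sum_t _)]/(k * (\sum_t _)).
rewrite mulr_sumr -big_split /=.
by apply: eq_bigr => t _; rewrite rcoef_lin mulrDr mulrCA.
Qed.

Lemma cell_act_linl l (x y : cell_module l) k a :
  cell_act (k *: x + y) a = k *: cell_act x a + cell_act y a.
Proof.
apply/ffunP=> v; rewrite !ffunE -[_ *: (\sum_t _)]/(k * (\sum_t _)).
rewrite mulr_sumr -big_split /=.
by apply: eq_bigr => t _; rewrite !ffunE mulrDl mulrA.
Qed.

Lemma cell_actM l (x : cell_module l) a b :
  cell_act x (a * b) = cell_act (cell_act x a) b.
Proof.
apply/ffunP=> w; rewrite !ffunE; under eq_bigr do rewrite rcoefM mulr_sumr.
rewrite exchange_big; apply: eq_bigr => v _; rewrite ffunE mulr_suml.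
by apply: eq_bigr => t _; rewrite mulrA.
Qed.

Lemma cell_act1 l (x : cell_module l) : cell_act x 1 = x.
Proof.
apply/ffunP=> v; rewrite ffunE (bigD1 v) //= rcoef1 eqxx mulr1 big1 ?addr0 //.
by move=> t /negPf ne; rewrite rcoef1 ne mulr0.
Qed.

Lemma cell_act0r l (x : cell_module l) : cell_act x 0 = 0.
Proof.
have := cell_act_linr x (-1) 0 0.
by rewrite scaler0 addr0 scaleN1r addNr.
Qed.

Lemma cell_actZr l (x : cell_module l) k a :
  cell_act x (k *: a) = k *: cell_act x a.
Proof. by rewrite -[k *: a]addr0 cell_act_linr cell_act0r addr0. Qed.

Lemma cell_act0l l a : cell_act (0 : cell_module l) a = 0.
Proof.
have := cell_act_linl (0 : cell_module l) 0 (-1) a.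
by rewrite scaler0 addr0 scaleN1r addNr.
Qed.

Lemma cell_actDl l (x y : cell_module l) a :
  cell_act (x + y) a = cell_act x a + cell_act y a.
Proof. by rewrite -[x]scale1r cell_act_linl !scale1r. Qed.

Lemma cell_actZl l (x : cell_module l) k a :
  cell_act (k *: x) a = k *: cell_act x a.
Proof. by rewrite -[k *: x]addr0 cell_act_linl cell_act0l addr0. Qed.

(** A cell outside the up-set [U] multiplied by an element of the ideal lands
    in the ideal, hence has no component on itself. *)
Lemma cell_act_ideal0 U l (x : cell_module l) a :
  up_closed U -> ~~ U l -> in_ideal U a -> cell_act x a = 0.
Proof.
move=> upU nUl Ua; apply/ffunP=> v; rewrite !ffunE big1 // => t _.
by rewrite (rcoefE t) (in_ideal_mull _ upU Ua) ?mulr0.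
Qed.

Lemma cell_act_ideal_unit U k e l (x : cell_module l) :
  (forall y, in_ideal U y -> y * e = k *: y) -> U l -> cell_act x e = k *: x.
Proof.
move=> eU Ul; apply/ffunP=> v; rewrite !ffunE (bigD1 v) //= (rcoefE v).
rewrite eU; last exact: in_ideal_basis.
rewrite cell_coordZ cell_coord_basis eqxx mulr1 [RHS]mulrC big1 ?addr0 //.
move=> t /negPf ne; rewrite (rcoefE v) eU; last exact: in_ideal_basis.
by rewrite cell_coordZ cell_coord_basis cell_idx_eq ne andbF !mulr0.
Qed.

(** Left multiplication, computed through the involution from the axiom on right
    multiplication. *)
Lemma cell_coord_mull l (s t u w : tab l) a :
  cell_coord C (a * cbasis (cell_idx s t)) (cell_idx u w) =
  (t == w)%:R * rcoef (star C a) s u.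
Proof.
have upgt : up_closed (fun mu => l < mu)%O.
  by move=> x y le lt; apply: lt_le_trans le.
have [_ JD JZ] := in_ideal_subspace (fun mu => l < mu)%O.
set b := star C a; pose r := \sum_v rcoef b s v *: cbasis (cell_idx v t) : A.
suff Jd : in_ideal (fun mu => l < mu)%O (a * cbasis (cell_idx s t) - r).
  rewrite -[a * _](subrK r) cell_coordD Jd ?ltxx // add0r cell_coord_sum.
  rewrite (bigD1 u) //= cell_coordZ cell_coord_basis cell_idx_eq eqxx mulrC.
  rewrite big1 ?addr0 // => v /negPf ne.
  by rewrite cell_coordZ cell_coord_basis cell_idx_eq ne mulr0.
pose c := cbasis (cell_idx t s) : A.
have -> : a * cbasis (cell_idx s t) - r =
  a * (cbasis (cell_idx s t) - star C c)
  + (star C (c * b - \sum_v rcoef b s v *: cbasis (cell_idx t v))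
  + \sum_v rcoef b s v *: (star C (cbasis (cell_idx t v)) - cbasis (cell_idx v t))).
  rewrite (linearB (star C)) starM starK (linear_sum (star C)) mulrBr.
  under [X in _ + (_ + X)]eq_bigr do rewrite scalerBr.
  rewrite sumrB; under [X in _ + (_ - X + _)]eq_bigr do rewrite linearZ.
  by rewrite [RHS]addrA [X in _ = X + _]addrA subrK addrA subrK.
have N x : in_ideal (fun mu => l < mu)%O x -> in_ideal (fun mu => l < mu)%O (- x).
  by move=> Jx; rewrite -scaleN1r; apply: JZ.
apply: (JD); last apply: (JD).
- by apply: in_ideal_mull => //; rewrite -opprB; apply/N/cell_gt_in_ideal/cell_star.
- by apply: in_ideal_star => //; apply/cell_gt_in_ideal/cell_mul.
apply: subspace_sum => [|v _]; first exact: in_ideal_subspace.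
by apply/JZ/cell_gt_in_ideal/cell_star.
Qed.

(** The product of two elements of one cell is governed by a bilinear form on
    the cell module: computed from the left, and modulo higher cells, the product
    c_tt c_ab only involves terms ending in [b], and the factor in front, the
    value of the form at ([t], [a]), does not depend on [b]. *)
Lemma rcoef_cbasis l (a b t v : tab l) :
  rcoef (cbasis (cell_idx a b) : A) t v =
  (b == v)%:R * rcoef (star C (cbasis (cell_idx t t))) a t.
Proof. by rewrite (rcoefE t) cell_coord_mull. Qed.

Lemma rcoef0_above l (t v : tab l) a :
  in_ideal (fun mu => l < mu)%O a -> rcoef a t v = 0.
Proof.
move=> Ja; rewrite (rcoefE t).
apply: (in_ideal_mull (U := fun mu => l < mu)%O) => //=.
  by move=> x y le lt; apply: lt_le_trans le.
by rewrite ltxx.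
Qed.

End Ideals.

(** * Identity elements of ideals over the field of fractions *)

Local Notation "x %:F" := (@FracField.tofrac _ x).

Lemma delta_mx_sandwich (F : fieldType) n (M : 'M[F]_n) (a b c d : 'I_n) :
  delta_mx c a *m M *m delta_mx b d = M a b *: delta_mx c d.
Proof.
apply/matrixP=> i j; rewrite !mxE (bigD1 b) //= big1 => [|e /negPf ne]; last first.
  by rewrite [X in _ * X]mxE ne mulr0.
rewrite !mxE (bigD1 a) //= big1 => [|e /negPf ne]; last first.
  by rewrite mxE ne andbF mul0r.
rewrite !mxE !eqxx !addr0 andbT; case: (i == c); last by rewrite !mul0r mulr0.
by rewrite mul1r.
Qed.

(** In a product of matrix algebras an ideal is a product of blocks: sandwiching
    an element with a nonzero entry in some block between matrix units of that
    block produces the identity of the block. *)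
Lemma split_semisimple_ideal_unit (F : fieldType) (B : algType F) (J : pred B) :
  split_semisimple B -> J 0 -> (forall x y, J x -> J y -> J (x + y)) ->
  (forall x y, J x -> J (x * y)) -> (forall x y, J y -> J (x * y)) ->
  exists2 e, J e & forall y, J y -> y * e = y.
Proof.
move=> [k [n [phi bij]]] J0 JD Jr Jl.
have phi_inj x y : (forall i, phi i x = phi i y) -> x = y.
  move=> xy; have [z [_ uz]] := bij (fun i => phi i y).
  by rewrite -(uz x) // -(uz y).
(* The family with [M] in the block [i] and 0 in the others. *)
pose blk i (M : 'M[F]_((n i).+1)) (i' : 'I_k) : 'M[F]_((n i').+1) :=
  match i =P i' with
  | ReflectT e => eq_rect i (fun i => 'M[F]_((n i).+1)) M i' e
  | ReflectF _ => 0
  end.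
have blk_same i M : blk i M i = M.
  by rewrite /blk; case: eqP => // e; rewrite eq_axiomK.
have blk_other i M i' : i != i' -> blk i M i' = 0.
  by rewrite /blk; case: eqP.
have lift i (M : 'M[F]_((n i).+1)) :
    exists x : B, phi i x = M /\ forall i', i != i' -> phi i' x = 0.
  have [x [phix _]] := bij (blk i M); exists x.
  by split=> [|i' ne]; rewrite phix ?blk_same ?blk_other.
have [u uP] : exists u : forall i : 'I_k, B,
    forall i, phi i (u i) = 1 /\ forall i', i != i' -> phi i' (u i) = 0.
  exact: (@fin_all_exists _ (fun=> B) (fun i x =>
    phi i x = 1 /\ forall i', i != i' -> phi i' x = 0) (fun i => lift i 1)).
have Ju i y : J y -> phi i y != 0 -> J (u i).
  move=> Jy /eqP/matrixP ne.
  have [a [b ab0]] : exists a b, phi i y a b != 0.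
    have [/existsP[a /existsP[b]]|no] :=
      boolP [exists a, exists b, phi i y a b != 0].
      by exists a, b.
    case: ne => a b; rewrite [RHS]mxE; apply/eqP.
    move: no; apply: contraNT => ab.
    by apply/existsP; exists a; apply/existsP; exists b.
  have [v vP] := @fin_all_exists _ (fun=> B)
    (fun c x => phi i x = delta_mx c a /\ forall i', i != i' -> phi i' x = 0)
    (fun c => lift i (delta_mx c a)).
  have [w wP] := @fin_all_exists _ (fun=> B)
    (fun c x => phi i x = delta_mx b c /\ forall i', i != i' -> phi i' x = 0)
    (fun c => lift i (delta_mx b c)).
  have -> : u i = \sum_c v c * y * ((phi i y a b)^-1 *: w c).
    apply: phi_inj => i'; rewrite rmorph_sum.
    have [<-|ne_i] := eqVneq i i'; last first.
      rewrite (uP i).2 // big1 // => c _.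
      by rewrite !rmorphM /= (vP c).2 // !mul0r.
    rewrite (uP i).1 -[1]/(1%:M) mx1_sum_delta; apply: eq_bigr => c _.
    rewrite !rmorphM /= linearZ /= (vP c).1 (wP c).1 -scalerAr.
    by rewrite -[_ * _]/(_ *m _ *m _) delta_mx_sandwich scalerA mulVf ?scale1r.
  by elim/big_ind: _ => // c _; apply/Jr/Jl.
exists (\sum_(i | J (u i)) u i) => [|y Jy].
  by elim/big_ind: _.
apply: phi_inj => i; rewrite rmorphM rmorph_sum /=.
have [phi0|phi0] := eqVneq (phi i y) 0; first by rewrite phi0 mul0r.
rewrite (bigD1 i) /=; last exact: Ju phi0.
by rewrite (uP i).1 big1 ?addr0 ?mulr1 // => j /andP[_ ne]; rewrite (uP j).2.
Qed.

Section IdealUnit.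
Variables (R : idomainType) (A : algType R) (C : cellular A).
Implicit Types (U : pred (hat C)).

Lemma fraction_denominator (z : {fraction R}) :
  exists ab : R * R, ab.2 != 0 /\ ab.2%:F * z = ab.1%:F.
Proof.
elim/quotW: z => f; exists (frac f); split; first exact: denom_ratioP.
unlock FracField.tofrac; rewrite -[LHS]FracField.pi_mul; apply/eqmodP.
rewrite /= FracField.equivfE /FracField.mulf.
by rewrite !numden_Ratio ?oner_neq0 ?mul1r ?mulr1 ?denom_ratioP.
Qed.

Lemma common_denominator (I : finType) (x : I -> {fraction R}) :
  exists (k : R) (y : I -> R), k != 0 /\ forall i, k%:F * x i = (y i)%:F.
Proof.
have [ab abP] := fin_all_exists (fun i => fraction_denominator (x i)).
exists (\prod_i (ab i).2), (fun i => (\prod_(j | j != i) (ab j).2) * (ab i).1).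
split=> [|i]; first by apply/prodf_neq0 => i _; have [] := abP i.
by rewrite (bigD1 i) //= !tofracM mulrAC (abP i).2 mulrC.
Qed.

Lemma ext_in_inj (a b : A) : ext_in C a = ext_in C b -> a = b.
Proof.
move=> /ffunP ab; rewrite (cell_coordK C a) (cell_coordK C b).
apply: eq_bigr => i _; have := ab i; rewrite !ffunE => /eqP.
by rewrite tofrac_eq => /eqP->.
Qed.

(** The ideal of [U] over the field of fractions, as a boolean predicate so that
    the blocks contained in it can be selected without excluded middle. *)
Definition ext_ideal U : pred (scalar_ext C) :=
  fun x => [forall i : cell_index (@tab _ _ C), U (tag i) || (x i == 0)].

Lemma ext_idealP U (x : scalar_ext C) :
  reflect (forall i : cell_index (@tab _ _ C), ~~ U (tag i) -> x i = 0)
    (ext_ideal U x).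
Proof.
apply: (iffP forallP) => [x0 i nUi|x0 i].
  by have := x0 i; rewrite (negPf nUi) => /eqP.
by have [//|nUi] := boolP (U (tag i)); rewrite x0 ?eqxx.
Qed.

Lemma ext_ideal_in U a : in_ideal U a -> ext_ideal U (ext_in C a).
Proof. by move=> Ua; apply/ext_idealP => i nUi; rewrite ffunE Ua. Qed.

Lemma ext_ideal0 U : ext_ideal U 0.
Proof. by apply/ext_idealP => i _; rewrite ffunE. Qed.

Lemma ext_idealD U x y : ext_ideal U x -> ext_ideal U y -> ext_ideal U (x + y).
Proof.
move=> /ext_idealP x0 /ext_idealP y0; apply/ext_idealP => i nUi.
by rewrite ffunE x0 // y0 // addr0.
Qed.

Lemma ext_idealZ U k x : ext_ideal U x -> ext_ideal U (k *: x).
Proof.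
move=> /ext_idealP x0; apply/ext_idealP => i nUi.
by rewrite ffunE x0 // scaler0.
Qed.

Lemma ext_ideal_span U (Q : scalar_ext C -> Prop) :
  (forall x y, Q x -> Q y -> Q (x + y)) -> (forall k x, Q x -> Q (k *: x)) ->
  (forall a, in_ideal U a -> Q (ext_in C a)) ->
  forall x, ext_ideal U x -> Q x.
Proof.
move=> QD QZ Qin x /ext_idealP x0; rewrite (ext_decomp x).
have Q0 : Q 0 by rewrite -(ext_in0 C); apply: Qin => i _; rewrite cell_coord0.
elim/big_ind: _ => // i _; have [Ui|nUi] := boolP (U (tag i)).
  exact/QZ/Qin/in_ideal_basis.
by rewrite x0 // scale0r.
Qed.

Lemma ext_ideal_mulr U x y : up_closed U -> ext_ideal U x -> ext_ideal U (x * y).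
Proof.
move=> upU; move: x; apply: ext_ideal_span => [x x' Jx Jx'|k x Jx|a Ja].
- by rewrite mulrDl ext_idealD.
- by rewrite -scalerAl ext_idealZ.
elim/ext_ind: y => [y y' Jy Jy'|k y Jy|b].
- by rewrite mulrDr ext_idealD.
- by rewrite -scalerAr ext_idealZ.
by rewrite -[_ * _]ext_inM; apply/ext_ideal_in/in_ideal_mulr.
Qed.

Lemma ext_ideal_mull U x y : up_closed U -> ext_ideal U y -> ext_ideal U (x * y).
Proof.
move=> upU; move: y; apply: ext_ideal_span => [y y' Jy Jy'|k y Jy|b Jb].
- by rewrite mulrDr ext_idealD.
- by rewrite -scalerAr ext_idealZ.
elim/ext_ind: x => [x x' Jx Jx'|k x Jx|a].
- by rewrite mulrDl ext_idealD.
- by rewrite -scalerAl ext_idealZ.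
by rewrite -[_ * _]ext_inM; apply/ext_ideal_in/in_ideal_mull.
Qed.

(** [e] is [k] times a right identity of the ideal of [U]; the scalar clears the
    denominators of the actual identity. *)
Definition ideal_unit U (k : R) (e : A) : Prop :=
  [/\ k != 0, in_ideal U e & forall y, in_ideal U y -> y * e = k *: y].

Lemma ideal_unit_exists U : split_semisimple (scalar_ext C) -> up_closed U ->
  exists k e, ideal_unit U k e.
Proof.
move=> ss upU.
have [e /ext_idealP Je eU] := split_semisimple_ideal_unit ss (ext_ideal0 U)
  (@ext_idealD U) (fun x y => @ext_ideal_mulr U x y upU)
  (fun x y => @ext_ideal_mull U x y upU).
have [k [g [k0 gE]]] := common_denominator e.
have eE : ext_in C (\sum_i g i *: cbasis i) = k%:F *: e.
  by apply/ffunP=> i; rewrite !ffunE cell_coord_comb -gE.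
exists k, (\sum_i g i *: cbasis i); split=> // [i nUi|y Jy].
  rewrite cell_coord_comb; apply/eqP; rewrite -tofrac_eq0 -gE Je //.
  by rewrite mulr0.
apply: ext_in_inj; rewrite ext_inM eE -ext_scaleAr.
rewrite [ext_mul _ _](eU _ (ext_ideal_in Jy)).
by rewrite -[k *: y]addr0 ext_in_lin ext_in0 addr0.
Qed.

(** It suffices to realize the endomorphisms of rank one, a functional [p] times a
    vector [y].  Let [e] be [k] times the identity of the ideal, [g] its matrix of
    coordinates on the cell [l], and [phi] the bilinear form of the cell.  That
    [e] acts as the scalar [k] means [phi * g = k]; so the columns of [g] yield
    [k] times the matrix units. *)
Lemma cell_act_dense (l : hat C) : split_semisimple (scalar_ext C) ->
  exists2 k : R, k != 0 & forall (p : tab l -> R) (y : cell_module l),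
    exists a : A, forall x : cell_module l,
      cell_act x a = (k * \sum_t x t * p t) *: y.
Proof.
move=> ss; pose U : pred (hat C) := fun mu => (l <= mu)%O.
have upU : up_closed U by move=> x y le_xy; move/le_trans; apply.
have [k [e [k0 Je eU]]] := ideal_unit_exists ss upU; exists k => // p y.
pose phi (t a : tab l) := rcoef (star C (cbasis (cell_idx t t))) a t : R.
pose g a b := cell_coord C e (@cell_idx _ _ l a b).
have gphi (t v : tab l) : \sum_a phi t a * g a v = k * (t == v)%:R :> R.
  have <- : rcoef e t v = k * (t == v)%:R.
    rewrite (rcoefE t) eU; last by apply: in_ideal_basis; apply: lexx.
    by rewrite cell_coordZ cell_coord_basis cell_idx_eq eqxx.
  pose e0 := \sum_a \sum_b g a b *: cbasis (cell_idx a b) : A.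
  (* Higher cells act as 0 on the cell module, so only the part [e0] of [e] on
     the cell [l] matters. *)
  have Jd : in_ideal (fun mu => l < mu)%O (e - e0).
    move=> [mu [s u]] /= nlt; rewrite -[- _]scaleN1r addrC cell_coord_lin.
    have [El|ne] := eqVneq l mu; last first.
      rewrite Je /=; last by apply: contra nlt; rewrite lt_neqAle ne.
      rewrite cell_coord_sum big1 ?mulr0 ?addr0 // => a _.
      rewrite cell_coord_sum big1 // => b _.
      rewrite cell_coordZ cell_coord_basis.
      rewrite (_ : _ == _ = false) ?mulr0 //.
      by apply: contraNF ne => /eqP/(congr1 tag) /= ->.
    case: _ / El s u nlt => s u _.
    rewrite cell_coord_sum (bigD1 s) //= cell_coord_sum (bigD1 u) //=.
    rewrite cell_coordZ cell_coord_basis eqxx mulr1.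
    rewrite big1 ?addr0 => [|b ne]; last first.
      by rewrite cell_coordZ cell_coord_basis cell_idx_eq (negPf ne) andbF mulr0.
    rewrite big1 => [|a ne]; last first.
      rewrite cell_coord_sum big1 // => b _.
      by rewrite cell_coordZ cell_coord_basis cell_idx_eq (negPf ne) mulr0.
    by rewrite addr0 mulN1r addNr.
  rewrite -[e](subrK e0) -[_ - _]scale1r rcoef_lin rcoef0_above // mulr0 add0r.
  rewrite (rcoefE t) mulr_sumr cell_coord_sum; apply: eq_bigr => a _.
  rewrite mulr_sumr cell_coord_sum (bigD1 v) //= -scalerAr cell_coordZ -rcoefE.
  rewrite rcoef_cbasis eqxx mul1r mulrC big1 ?addr0 // => b ne.
  by rewrite -scalerAr cell_coordZ -rcoefE rcoef_cbasis (negPf ne) mul0r mulr0.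
pose munit (s v : tab l) := \sum_a g a s *: cbasis (cell_idx a v) : A.
have munitE (s v t w : tab l) : rcoef (munit s v) t w = k * (t == s)%:R * (v == w)%:R.
  rewrite rcoef_sum -gphi mulr_suml; apply: eq_bigr => a _.
  by rewrite rcoef_cbasis mulrCA mulrC [g _ _ * _]mulrC.
exists (\sum_s p s *: \sum_v y v *: munit s v) => x.
apply/ffunP=> w; rewrite ffunE [RHS]ffunE -[_ *: y w]/(_ * y w).
rewrite mulr_sumr mulr_suml; apply: eq_bigr => t _.
rewrite rcoef_sum (bigD1 t) //= [X in _ + X]big1 ?addr0 => [|s ne].
  rewrite rcoef_sum (bigD1 w) //= [X in _ + X]big1 ?addr0 => [|v ne].
    have comm4 (a b c d : R) : a * (b * (c * d)) = d * (a * b) * c.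
      by rewrite [d * _]mulrC !mulrA [RHS]mulrAC.
    by rewrite munitE !eqxx !mulr1; apply: comm4.
  by rewrite munitE (negPf ne) !mulr0.
rewrite rcoef_sum big1 ?mulr0 // => v _.
by rewrite munitE eq_sym (negPf ne) mulr0 mul0r mulr0.
Qed.

End IdealUnit.

(** * Bases lifted along a filtration *)

Section Filtration.
Variables (R : idomainType) (A : algType R) (C : cellular A).
Variables (N : lmodType R) (act : N -> A -> N) (f : cell_filtration C act).

Lemma fsub_subspace i : (i <= flen f)%N -> subspace (fsub f i).
Proof. by move=> /(fsub_submod (c := f))[]. Qed.

Lemma fsub_leq i j x : (i <= j <= flen f)%N -> fsub f i x -> fsub f j x.
Proof.
case/andP=> /subnK <-; elim: (j - i)%N => // d IHd lt_d fx.
exact: (fsub_le (i := Ordinal lt_d)) (IHd (ltnW lt_d) fx).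
Qed.

Lemma fproj0 (i : 'I_(flen f)) : fproj i (0 : N) = 0.
Proof.
have [F0 _ _] := fsub_subspace (ltnW (ltn_ord i)).
by apply/fproj_ker => //; apply: fsub_le.
Qed.

Lemma fprojZ (i : 'I_(flen f)) k x :
  fsub f i.+1 x -> fproj i (k *: x) = k *: fproj i x.
Proof.
move=> fx; rewrite -[k *: x]addr0 fproj_lin //; last first.
  by case: (fsub_subspace (ltn_ord i)).
by rewrite fproj0 addr0.
Qed.

Lemma fproj_sum (i : 'I_(flen f)) (I : finType) (v : I -> N) :
  (forall j, fsub f i.+1 (v j)) -> fproj i (\sum_j v j) = \sum_j fproj i (v j).
Proof.
move=> fv; have [_ FD _] := fsub_subspace (ltn_ord i).
suff [] : fsub f i.+1 (\sum_j v j) /\ fproj i (\sum_j v j) = \sum_j fproj i (v j).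
  by [].
elim/big_rec2: _ => [|j y x _ [fx <-]].
  by split; [case: (fsub_subspace (ltn_ord i)) | exact: fproj0].
split; first exact: FD.
by have := fproj_lin 1 (fv j) fx; rewrite !scale1r.
Qed.

(** Spanning follows by subtracting lifts from the top of the filtration down;
    a linear relation is killed in the same order, by projecting it to the top
    subquotient in which it is still nontrivial. *)
Lemma filtration_basis (I : 'I_(flen f) -> finType)
    (b : forall j, I j -> cell_module (fshape j)) (B : {j & I j} -> N) :
  (forall j, is_basis (@b j)) ->
  (forall p : {j & I j}, fsub f (tag p).+1 (B p)) ->
  (forall p : {j & I j}, fproj (tag p) (B p) = b (tag p) (tagged p)) ->
  is_basis B.
Proof.
move=> bP fB pB; split=> [x|k k0].
  apply: lin_span_family; have [S0 SD SZ] :=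
    lin_span_subspace (fun y => exists p, y = B p).
  suff H m y : (m <= flen f)%N -> fsub f m y ->
      lin_span (fun y => exists p, y = B p) y by apply: H (fsub_len f x).
  elim: m y => {x} [|m IHm] x lt_m; first by move=> /(fsub0 f) ->.
  move=> fx; pose j := Ordinal lt_m.
  pose y := \sum_i basis_coord (bP j) (fproj j x) i *: B (Tagged I i).
  have [_ FD FZ] := fsub_subspace lt_m.
  have fy i : fsub f j.+1 (basis_coord (bP j) (fproj j x) i *: B (Tagged I i)).
    exact/FZ/(fB (Tagged I i)).
  have fsy : fsub f j.+1 y by apply: subspace_sum => //; apply: fsub_subspace.
  rewrite -[x](subrK y); apply: SD.
    apply: IHm; first exact: ltnW.
    apply/(fproj_ker (i := j)); first exact: subspaceB (fsub_subspace _) _ _.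
    rewrite addrC -scaleN1r fproj_lin // fproj_sum //.
    rewrite (eq_bigr (fun i => basis_coord (bP j) (fproj j x) i *: b j i)).
      by rewrite -basis_coordK scaleN1r addNr.
    by move=> i _; rewrite fprojZ ?(pB (Tagged I i)) //; apply: (fB (Tagged I i)).
  apply: subspace_sum; first exact: lin_span_subspace.
  by move=> i _; apply/SZ/lin_span_incl; eexists.
suff H m : (m <= flen f)%N ->
    forall p : {j & I j}, (flen f - m <= tag p)%N -> k p = 0.
  by move=> p; apply: (H (flen f)) => //; rewrite subnn.
elim: m => [_ p|m IHm lt_m p].
  by rewrite subn0 leqNgt ltn_ord.
rewrite leq_eqVlt => /orP[/eqP Ep|lt_p]; last first.
  by apply: IHm => //; [exact: ltnW | rewrite -(subnSK lt_m)].
case: p Ep => j i /= Ep.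
have gt0 (p : {j & I j}) : (j < tag p)%N -> k p = 0.
  by move=> ltp; apply: IHm; [exact: ltnW | rewrite -(subnSK lt_m) Ep].
have [F0 FD FZ] := fsub_subspace (ltn_ord j).
have fkB (p : {j & I j}) : fsub f j.+1 (k p *: B p).
  have [ltp|le_p] := ltnP j (tag p); first by rewrite gt0 // scale0r.
  by apply/FZ/(fsub_leq _ (fB p)); rewrite ltnS le_p ltn_ord.
have other (p : {j & I j}) : tag p != j -> fproj j (k p *: B p) = 0.
  rewrite neq_ltn => /orP[ltp|ltp]; last by rewrite gt0 // scale0r fproj0.
  apply/fproj_ker => //; have [_ _ FZ'] := fsub_subspace (ltnW (ltn_ord j)).
  by apply/FZ'/(fsub_leq _ (fB p)); rewrite ltp ltnW.
suff : \sum_i0 [ffun i0 => k (Tagged I i0)] i0 *: b j i0 = 0.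
  by move/((bP j).2 _) => /(_ i); rewrite ffunE.
have /(congr1 (fproj j)) := k0; rewrite fproj0 fproj_sum // => k0'.
transitivity (\sum_(p : {j & I j}) fproj j (k (Tagged I (tagged p)) *:
    B (Tagged I (tagged p)))); last by rewrite -[RHS]k0'; apply: eq_bigr => -[].
transitivity (\sum_j' \sum_(i' : I j') fproj j (k (Tagged I i') *: B (Tagged I i')));
  last by rewrite sig_big_dep.
rewrite [RHS](bigD1 j) //= [X in _ = _ + X]big1 => [|j' ne_j]; last first.
  by rewrite big1 // => i' _; apply: other.
rewrite addr0; apply: eq_bigr => i' _.
by rewrite ffunE fprojZ ?(pB (Tagged I _)) //; apply: (fB (Tagged I _)).
Qed.

End Filtration.

(** * The Murphy basis *)

Section StdPaths.
Variables (R : idomainType) (D : diagram_algebras R).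
Implicit Types (t u : path_fun D).

Lemma vertex_inhabited r : exists l : vertex D r, true.
Proof.
have [l _|no] := pickP (fun _ : vertex D r => true); first by exists l.
have /eqP[] := oner_neq0 (dalg D r).
by rewrite (cell_coordK (dcell D r) 1) big1 // => -[l st]; have := no l.
Qed.

Definition some_path : path_fun D := fun r => xchoose (vertex_inhabited r).

Definition set_level r (nu : vertex D r) t : path_fun D := fun j =>
  match r =P j with
  | ReflectT e => eq_rect r (vertex D) nu j e
  | ReflectF _ => t j
  end.

Lemma set_level_same r (nu : vertex D r) t : set_level nu t r = nu.
Proof. by rewrite /set_level; case: eqP => // e; rewrite eq_axiomK. Qed.

Lemma set_level_other r (nu : vertex D r) t j : j != r -> set_level nu t j = t j.
Proof. by rewrite /set_level eq_sym; case: eqP. Qed.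

Lemma dpath_ext r t u :
  (forall j, (j <= r)%N -> t j = u j) -> dpath t r = dpath u r.
Proof.
elim: r => // r IHr tu /=; rewrite !tu // IHr // => j le_jr.
exact/tu/leqW.
Qed.

(** Finite index sets for the paths ending at a vertex.  They record steps of the
    restriction filtrations rather than vertices, which makes them match
    [filtration_basis]; by [std_path_surj] they still account for every path. *)
Fixpoint std r : vertex D r -> finType :=
  match r with
  | 0 => fun _ => unit : finType
  | r'.+1 => fun nu => {i : 'I_(flen (dfilt nu)) & std (fshape i)} : finType
  end.

Fixpoint std_path r : forall nu : vertex D r, std nu -> path_fun D :=
  match r with
  | 0 => fun _ _ => some_path
  | r'.+1 => fun nu i => set_level nu (std_path (tagged i))
  end.

Lemma is_Std0_extend r (nu : vertex D r.+1) (j : 'I_(flen (dfilt nu))) t :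
  is_Std0 (fshape j) t -> is_Std0 nu (set_level nu t).
Proof.
move=> [t0 tr edges]; split=> [||i /= lt_ir].
- exact: dempty_uniq.
- exact: set_level_same.
rewrite set_level_other ?ltn_eqF //.
move: lt_ir; rewrite ltnS leq_eqVlt => /orP[/eqP ->|lt_ir].
  by rewrite set_level_same tr; apply/existsP; exists j.
by rewrite set_level_other ?edges // ltn_eqF.
Qed.

Lemma std_pathP r (nu : vertex D r) (i : std nu) : is_Std0 nu (std_path i).
Proof.
elim: r nu i => [|r IHr] nu i; last exact: is_Std0_extend (IHr _ _).
by split=> //; rewrite ?[LHS]dempty_uniq // [RHS]dempty_uniq.
Qed.

Lemma std_path_surj r (nu : vertex D r) t : is_Std0 nu t ->
  exists i : std nu, forall j, (j <= r)%N -> std_path i j = t j.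
Proof.
elim: r nu => [|r IHr] nu [t0 tr edges].
  exists tt => j; rewrite leqn0 => /eqP ->.
  by rewrite [LHS]dempty_uniq [RHS]dempty_uniq.
subst nu; have /existsP[i /eqP Ei] := edges r (ltnSn r).
have [|i' Ei'] := IHr (fshape i).
  by split=> // j lt_jr; apply: edges; apply: leqW.
exists (Tagged (fun i => std (fshape i)) i') => j; rewrite leq_eqVlt.
case/orP=> [/eqP ->|lt_jr]; first exact: set_level_same.
by rewrite /= set_level_other ?ltn_eqF // Ei'.
Qed.

Lemma murphy_extend r (nu : vertex D r.+1) (j : 'I_(flen (dfilt nu))) t :
  t r = fshape j ->
  fsub (dfilt nu) j.+1 (murphy nu (set_level nu t)) /\
  fproj j (murphy nu (set_level nu t)) = murphy (fshape j) t.
Proof.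
move=> tr; have -> : murphy nu (set_level nu t) =
    cell_act (cell_act (dgen nu) (dbranch (fshape j) nu)) (dincl D r (dpath t r)).
  rewrite /murphy /= set_level_same set_level_other ?ltn_eqF // tr cell_actM.
  congr cell_act; congr (dincl D r _); apply: dpath_ext => i le_ir.
  by rewrite set_level_other // ltn_eqF.
have fb := dbranch_sub j; split; last by rewrite fproj_act // dbranch_proj.
by have [_ _ _] := fsub_submod (c := dfilt nu) (ltn_ord j); apply.
Qed.

Lemma dgen_neq0 r (nu : vertex D r) : (0 < #|tab nu|)%N -> exists s, dgen nu s != 0.
Proof.
move=> /card_gt0P[v _]; apply/existsP.
rewrite -negb_forall; apply/negP => /forallP g0.
have [a /ffunP/(_ v)] := dgen_cyclic (l := nu) [ffun=> 1].
rewrite !ffunE big1 => [/eqP|t _]; first by rewrite oner_eq0.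
by have /eqP-> := g0 t; rewrite mul0r.
Qed.

Lemma murphy_basis r (nu : vertex D r) :
  is_basis (fun i : std nu => murphy nu (std_path i)).
Proof.
elim: r nu => [|r IHr] nu; last first.
  apply: (filtration_basis (b := fun j i => murphy (fshape j) (std_path i))) => //.
  - by move=> [j i]; apply: (murphy_extend _).1; have [] := std_pathP i.
  - by move=> [j i]; apply: (murphy_extend _).2; have [] := std_pathP i.
have b0 : murphy nu some_path = dgen nu by apply: cell_act1.
split=> [y|k].
  have [a ->] := dgen_cyclic y; have [c ->] := dalg0 a.
  exists [ffun=> c]; rewrite (bigD1 tt) //= big1 ?addr0 => [|[] //].
  by rewrite ffunE b0 cell_actZr cell_act1.
rewrite (bigD1 tt) //= big1 ?addr0 => [|[] //] k0 [].
have [|s s0] := @dgen_neq0 _ nu; first by rewrite (dempty_uniq nu) dtab0.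
have /ffunP/(_ s)/eqP := k0; rewrite b0 !ffunE.
by rewrite mulf_eq0 (negPf s0) orbF => /eqP.
Qed.

Definition span_paths r (nu : vertex D r) (P : pred (path_fun D)) :
    cell_module nu -> Prop :=
  lin_span (fun x => exists t, [/\ is_Std0 nu t, P t & x = murphy nu t]).

Lemma span_paths_subspace r (nu : vertex D r) (P : pred (path_fun D)) :
  subspace (span_paths (nu := nu) P).
Proof. exact: lin_span_subspace. Qed.

Lemma span_pathsE r (nu : vertex D r) (P : pred (path_fun D)) x :
  (forall t u, (forall j, (j <= r)%N -> t j = u j) -> P t = P u) ->
  span_paths P x <-> lin_span (fun y =>
    exists2 i : std nu, P (std_path i) & y = murphy nu (std_path i)) x.
Proof.
move=> extP; split; apply: lin_span_min; try exact: lin_span_subspace.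
  move=> _ [t [St Pt ->]]; have [i Ei] := std_path_surj St.
  apply: lin_span_incl; exists i; first by rewrite (extP _ _ Ei).
  by congr cell_act; apply: dpath_ext => j /Ei.
move=> _ [i Pi ->]; apply: lin_span_incl; exists (std_path i).
by split=> //; apply: std_pathP.
Qed.

(** The condition on [P] makes membership depend only on the part of a path that
    enters its Murphy vector. *)
Lemma span_paths_saturated r (nu : vertex D r) (P : pred (path_fun D)) k x :
  (forall t u, (forall j, (j <= r)%N -> t j = u j) -> P t = P u) ->
  k != 0 -> span_paths (nu := nu) P (k *: x) -> span_paths P x.
Proof.
move=> extP k0 /(span_pathsE _ extP) Skx; apply/(span_pathsE _ extP).
exact: (lin_span_subbasis_saturated (P := fun i => P (std_path i))
  (murphy_basis nu) k0 Skx).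
Qed.

Lemma murphy_in_span r (nu : vertex D r) (P : pred (path_fun D)) t :
  is_Std0 nu t -> P t -> span_paths P (murphy nu t).
Proof. by move=> St Pt; apply: lin_span_incl; exists t. Qed.

End StdPaths.

(** * Path segments above a fixed level *)

Section Segments.
Variables (R : idomainType) (D : diagram_algebras R) (s : nat).
Implicit Types (t u : path_fun D).

Fixpoint incl n : dalg D s -> dalg D (n + s) :=
  match n with
  | 0 => fun a => a
  | n'.+1 => fun a => dincl D (n' + s) (incl n' a)
  end.

Lemma incl_lin n k (a b : dalg D s) :
  incl n (k *: a + b) = k *: incl n a + incl n b.
Proof. by elim: n => //= n ->; rewrite linearP. Qed.

Lemma inclZ n k (a : dalg D s) : incl n (k *: a) = k *: incl n a.
Proof. by elim: n => //= n ->; rewrite linearZ. Qed.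

Lemma inclM n (a b : dalg D s) : incl n (a * b) = incl n a * incl n b.
Proof. by elim: n => //= n ->; rewrite rmorphM. Qed.

Lemma incl_from_level n (a : dalg D s) : from_level s (incl n a).
Proof. by elim: n => [|n IHn]; constructor. Qed.

Fixpoint dseg n t : dalg D (n + s) :=
  match n with
  | 0 => 1
  | n'.+1 => dbranch (t (n' + s)%N) (t (n'.+1 + s)%N) * dincl D (n' + s) (dseg n' t)
  end.

Lemma dpath_split n t : dpath t (n + s) = dseg n t * incl n (dpath t s).
Proof.
elim: n => [|n IHn]; first by rewrite mul1r.
by rewrite [LHS]/= IHn rmorphM mulrA.
Qed.

Lemma dseg_ext n t u :
  (forall j, (s <= j <= n + s)%N -> t j = u j) -> dseg n t = dseg n u.
Proof.
elim: n => // n IHn tu /=; rewrite IHn => [|j /andP[ge le]]; last first.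
  by apply: tu; rewrite ge leqW.
by rewrite !tu // ?leq_addl ?leqnn ?leqnSn.
Qed.

(** The relation [du_eq], iterated from level [n + s] down to level [s]. *)
Lemma dm_dseg n t : (forall j, (s <= j < n + s)%N -> dedge (t j) (t j.+1)) ->
  exists w, dm (t (n + s)%N) * dseg n t = w * incl n (dm (t s)).
Proof.
elim: n => [|n IHn] edges; first by exists 1; rewrite mulr1 mul1r.
have [|w wE] := IHn; first by move=> j /andP[ge lt]; rewrite edges ?ge // ltnW.
exists (star (dcell D _) (du (t (n + s)%N) (t (n.+1 + s)%N)) * dincl D _ w).
rewrite /= mulrA (du_eq (edges _ _)); last by rewrite leq_addl ltnSn.
by rewrite -!mulrA -!rmorphM wE.
Qed.

End Segments.

(** * Cell generators and the elements m_nu *)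

Section CellGenerator.
Variables (R : idomainType) (D : diagram_algebras R).

Lemma in_ideal_dm r (nu : vertex D r) (U : pred (vertex D r)) b :
  up_closed U -> U nu -> in_ideal U (dm nu * b).
Proof.
move=> upU Unu; apply: in_ideal_mulr => //.
apply: in_ideal_sub (cell_ge_in_ideal (dm_ge nu)) => mu le_nu.
exact: upU le_nu Unu.
Qed.

Lemma up_closed_gt r (nu : vertex D r) : up_closed (fun mu => nu < mu)%O.
Proof. by move=> x y le_xy lt_x; apply: lt_le_trans le_xy. Qed.

Lemma up_closed_ge r (nu : vertex D r) : up_closed (fun mu => nu <= mu)%O.
Proof. by move=> x y le_xy le_x; apply: le_trans le_xy. Qed.

(** Transfers identities from the algebra, where [dm nu] can be moved across
    [dseg], to the cell module; it uses that the coefficients of [dgen nu] are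
    not all zero, over an integral domain. *)
Lemma dgen_act_eq0 r (nu : vertex D r) b :
  cell_act (dgen nu) b = 0 <-> in_ideal (fun mu => nu < mu)%O (dm nu * b).
Proof.
have /cell_gt_in_ideal J := cell_rep_act b (dm_gen nu).
split=> [b0|Jb].
  have rep0 : cell_rep (dgen nu) (cell_act (dgen nu) b) = 0.
    rewrite b0 /cell_rep big1 // => s _; rewrite big1 // => t _.
    by rewrite ffunE mulr0 scale0r.
  by move: J; rewrite rep0 subr0.
have Jrep : in_ideal (fun mu => nu < mu)%O
    (cell_rep (dgen nu) (cell_act (dgen nu) b)).
  rewrite -[cell_rep _ _](subKr (dm nu * b)).
  exact: subspaceB (in_ideal_subspace _) Jb J.
apply/ffunP=> t; rewrite [RHS]ffunE.
have [|s s0] := @dgen_neq0 _ _ _ nu; first by apply/card_gt0P; exists t.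
have := Jrep (cell_idx s t); rewrite /= ltxx => /(_ isT).
rewrite cell_coord_sum (bigD1 s) //= cell_coord_sum (bigD1 t) //=.
rewrite cell_coordZ cell_coord_basis eqxx mulr1 big1 => [|t' /negPf ne]; last first.
  by rewrite cell_coordZ cell_coord_basis cell_idx_eq ne andbF mulr0.
rewrite big1 => [|s' /negPf ne]; last first.
  rewrite cell_coord_sum big1 // => t' _.
  by rewrite cell_coordZ cell_coord_basis cell_idx_eq ne mulr0.
by move=> /eqP; rewrite !addr0 mulf_eq0 (negPf s0) => /eqP.
Qed.

End CellGenerator.

(** * The image of the identity of a cell ideal *)

Section Unit.
Variables (R : idomainType) (D : diagram_algebras R) (s : nat).
Variables (U : pred (vertex D s)) (k : R) (e : dalg D s).
Hypotheses (upU : up_closed U) (eP : ideal_unit U k e).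
Implicit Types (t u : path_fun D).

Let inU : pred (path_fun D) := fun t => U (t s).

Let inU_ext n t u : (forall j, (j <= n + s)%N -> t j = u j) -> inU t = inU u.
Proof. by rewrite /inU => ->; rewrite ?leq_addl. Qed.

(** By [dm_dseg] the element [dm nu * dseg * b] is a left multiple of an element
    of the ideal of [U], on which [e] acts from the right by [k]. *)
Lemma dseg_act_unit n t b :
  (forall j, (s <= j < n + s)%N -> dedge (t j) (t j.+1)) ->
  in_ideal U (dm (t s) * b) ->
  let x := cell_act (dgen (t (n + s)%N)) (dseg s n t * incl n b) in
  cell_act x (incl n e) = k *: x.
Proof.
move=> edges Ub x; have [_ _ eU] := eP; have [w wE] := dm_dseg edges.
apply/subr0_eq; rewrite -scaleN1r addrC scalerA -cell_actM mulN1r -cell_act_linr.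
apply/dgen_act_eq0; rewrite mulrDr -scalerAr.
suff -> : dm (t (n + s)%N) * (dseg s n t * incl n b * incl n e) =
  k *: (dm (t (n + s)%N) * (dseg s n t * incl n b)).
  by rewrite -scalerDl addNr scale0r => i _; rewrite cell_coord0.
by rewrite !mulrA wE -!mulrA -!inclM mulrA eU // inclZ -scalerAr.
Qed.

Lemma murphy_act_unit n (nu : vertex D (n + s)) t : is_Std0 nu t -> U (t s) ->
  cell_act (murphy nu t) (incl n e) = k *: murphy nu t.
Proof.
move=> [_ tn edges] Ut; subst nu; rewrite /murphy dpath_split.
apply: dseg_act_unit; first by move=> j /andP[_ lt]; apply: edges.
exact: in_ideal_dm.
Qed.

Lemma span_act_unit n (nu : vertex D (n + s)) x : span_paths inU x ->
  cell_act x (incl n e) = k *: x :> cell_module nu.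
Proof.
move: x; apply: lin_span_min => [|_ [t [St Ut ->]]]; last exact: murphy_act_unit.
split=> [|x y Ex Ey|c x Ex]; first by rewrite cell_act0l scaler0.
  by rewrite cell_actDl Ex Ey scalerDr.
by rewrite cell_actZl Ex !scalerA mulrC.
Qed.

(** Both inductions, on the level and on the step [m] of the filtration, use that
    [e * e = k *: e].  If [y] is a lift to the span of the image of [x * e] in a
    subquotient, then [x * e - y] lies one step lower, so applying [e] again to
    [x * e = y + (x * e - y)] puts [k *: (x * e)] in the span. *)
Lemma act_unit_span n (nu : vertex D (n + s)) (x : cell_module nu) :
  span_paths inU (cell_act x (incl n e)).
Proof.
have [k0 Je eU] := eP.
elim: n nu x => [|n IHn] nu x.
  have [S0 SD SZ] := span_paths_subspace nu inU.
  have [Unu|nUnu] := boolP (U nu); last by rewrite (cell_act_ideal0 _ upU).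
  rewrite (cell_act_ideal_unit _ eU) //; apply: (SZ).
  rewrite (basis_coordK (murphy_basis nu) x).
  apply: subspace_sum => [|i _]; first exact: span_paths_subspace.
  apply: (SZ); apply: murphy_in_span.
    exact: std_pathP.
  by rewrite /inU; have [_ -> _] := std_pathP i.
set f := dfilt nu; have := fsub_len f x.
suff H m y : (m <= flen f)%N -> fsub f m y ->
    span_paths inU (cell_act y (incl n.+1 e)) by apply: H.
have [S0 SD SZ] := span_paths_subspace nu inU.
elim: m y => {x} [|m IHm] x lt_m; first by move=> /(fsub0 f) ->; rewrite cell_act0l.
pose j : 'I_(flen f) := Ordinal lt_m => fx.
have [F0 FD FZ Fact] := fsub_submod (c := f) lt_m.
(* Appending [nu] to the paths lifts the span at the previous level to the span
   at [nu]. *)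
have lift z : span_paths inU z ->
    exists y, [/\ span_paths inU y, fsub f j.+1 y & fproj j y = z].
  move: z; apply: lin_span_min => [|_ [t [St Ut ->]]].
    split=> [|_ _ [y [Sy fy <-]] [y' [Sy' fy' <-]]|c _ [y [Sy fy <-]]].
    - by exists 0; rewrite fproj0.
    - exists (y + y'); split; [exact: SD|exact: FD|].
      by have := fproj_lin 1 fy fy'; rewrite !scale1r.
    by exists (c *: y); split; [exact: SZ|exact: FZ|exact: fprojZ].
  have [_ tn _] := St; have [fm pm] := murphy_extend tn.
  exists (murphy nu (set_level nu t)); split=> //.
  apply: murphy_in_span; first exact: is_Std0_extend St.
  by rewrite /inU set_level_other // ltn_eqF // ltnS leq_addl.
have [y [Sy fy pE]] := lift _ (IHn _ (fproj j x)).
have fxe : fsub f j.+1 (cell_act x (incl n.+1 e)) by apply: Fact.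
have Sd : span_paths inU (cell_act (cell_act x (incl n.+1 e) - y) (incl n.+1 e)).
  apply: IHm; first exact: ltnW.
  apply/(fproj_ker (i := j)).
    by apply: subspaceB => //; apply: fsub_subspace.
  rewrite addrC -scaleN1r fproj_lin // pE fproj_act //.
  by rewrite scaleN1r addNr.
apply: (span_paths_saturated (@inU_ext n.+1) k0).
rewrite -[X in span_paths _ X](subrK (cell_act y (incl n.+1 e))).
apply: (SD); last by rewrite (span_act_unit (n := n.+1) Sy); apply: (SZ).
have -> : k *: cell_act x (incl n.+1 e) =
    cell_act (cell_act x (incl n.+1 e)) (incl n.+1 e).
  by rewrite -cell_actM -(inclM n.+1) eU // inclZ cell_actZr.
by rewrite -scaleN1r -cell_actZl -cell_actDl scaleN1r.
Qed.

(** How congruences modulo higher cells at level [s] become congruences modulo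
    the span of higher paths at level [n + s]. *)
Lemma dseg_in_span n t b :
  (forall j, (s <= j < n + s)%N -> dedge (t j) (t j.+1)) ->
  in_ideal U (dm (t s) * b) ->
  span_paths inU (cell_act (dgen (t (n + s)%N)) (dseg s n t * incl n b)).
Proof.
move=> edges Ub; have [k0 _ _] := eP.
apply: (span_paths_saturated (@inU_ext n) k0).
by rewrite -dseg_act_unit //; apply: act_unit_span.
Qed.

Lemma commutant_span n (nu : vertex D (n + s)) (x : cell_module nu)
    (a : dalg D (n + s)) :
  rel_commutant D s _ a ->
  span_paths inU x -> span_paths inU (cell_act x a).
Proof.
move=> ca Sx; have [k0 _ _] := eP.
apply: (span_paths_saturated (@inU_ext n) k0).
rewrite -cell_actZl -span_act_unit // -cell_actM -ca; last exact: incl_from_level.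
by rewrite cell_actM; apply: act_unit_span.
Qed.

End Unit.

(** * Paths that begin with a given path *)

Section Main.
Variables (R : idomainType) (D : diagram_algebras R) (s n : nat).
Variables (nu : vertex D (n + s)) (tl : path_fun D).
Hypothesis tlS : is_Std0 (tl s) tl.
Let l := tl s.

Let gt_l : pred (path_fun D) := fun t => (l < t s)%O.
Let starts_tl : pred (path_fun D) := fun t => [forall j : 'I_s.+1, t j == tl j].
Let gt_or_tl : pred (path_fun D) := fun t => gt_l t || starts_tl t.

Lemma starts_tlP t : reflect (forall j, (j <= s)%N -> t j = tl j) (starts_tl t).
Proof.
apply: (iffP forallP) => [tE j le_js|tE j]; last by rewrite tE // -ltnS.
exact/eqP/(tE (Ordinal (le_js : (j < s.+1)%N))).
Qed.

Lemma path_comp_Std0 t : is_Std l nu t -> is_Std0 nu (path_comp s tl t).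
Proof.
move=> [ts tn edges]; have [tl0 _ tl_edges] := tlS; rewrite /path_comp; split=> //.
  case: leqP => // le_ns; have n0 : n = 0%N.
    by move: le_ns; rewrite -{2}[s]add0n leq_add2r leqn0 => /eqP.
  by subst n; rewrite -tn ts.
move=> j /= lt_j; case: (ltngtP j s) => [lt_js|lt_sj|].
- by apply: tl_edges.
- by apply: edges; rewrite ltnW.
move=> Ej; subst j; rewrite -/l -ts; apply: edges.
by rewrite leqnn.
Qed.

Lemma murphy_starts_tl t : is_Std0 nu t -> starts_tl t ->
  Delta_path nu l tl (murphy nu t).
Proof.
move=> [t0 tn edges] /starts_tlP tE; apply: lin_span_incl; exists t; split.
  split=> //; first exact: tE.
  by move=> j /andP[_ lt]; apply: edges.
congr cell_act; apply: dpath_ext => j _; rewrite /path_comp.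
by case: leqP => // /tE.
Qed.

(** The sum of the theorem is itself spanned by Murphy vectors, hence saturated. *)
Lemma addsub_spanE x :
  addsub (Delta_path nu l tl) (Delta_gt nu l) x <->
  span_paths (nu := nu) gt_or_tl x.
Proof.
have [S0 SD SZ] := span_paths_subspace nu gt_or_tl.
split=> [[y [z [Py Gz ->]]]|].
  apply: (SD); [move: y Py | move: z Gz]; apply: lin_span_min => //.
    move=> _ [t [St ->]]; apply: murphy_in_span; first exact: path_comp_Std0.
    by apply/orP; right; apply/starts_tlP => j le_js; rewrite /path_comp le_js.
  by move=> _ [t [St lt ->]]; apply: murphy_in_span => //; apply/orP; left.
have [P0 PD PZ] := lin_span_subspace
  (fun x => exists t, is_Std l nu t /\ x = murphy nu (path_comp s tl t)).
have [G0 GD GZ] := span_paths_subspace nu gt_l.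
move: x; apply: lin_span_min => [|_ [t [St /orP[lt|tE] ->]]].
- split=> [|_ _ [y [z [Py Gz ->]]] [y' [z' [Py' Gz' ->]]]|c _ [y [z [Py Gz ->]]]].
  + by exists 0, 0; rewrite addr0.
  + exists (y + y'), (z + z'); rewrite addrACA.
    by split=> //; [exact: PD|exact: GD].
  by exists (c *: y), (c *: z); rewrite scalerDr; split=> //; [exact: PZ|exact: GZ].
- exists 0, (murphy nu t); rewrite add0r; split=> //; exact: murphy_in_span.
exists (murphy nu t), 0; rewrite addr0; split=> //; exact: murphy_starts_tl.
Qed.

Lemma gt_span_stable x (a : dalg D (n + s)) : rel_commutant D s _ a ->
  span_paths (nu := nu) gt_l x -> span_paths gt_l (cell_act x a).
Proof.
have [k [e eP]] := ideal_unit_exists (dsplit D s) (up_closed_gt (nu := l)).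
exact: (commutant_span (up_closed_gt (nu := l)) eP).
Qed.

(** Given by [cell_act_dense] for the coordinate functional of the Murphy vector
    of [tl]. *)
Lemma projection_exists : exists (k : R) (a : dalg D s), k != 0 /\
  exists c : cell_module l -> R, c (murphy l tl) = k /\
  forall x : cell_module l, cell_act x a = c x *: murphy l tl.
Proof.
have [k k0 dense] := cell_act_dense l (dsplit D s).
have [i iE] := std_path_surj tlS.
pose c (x : cell_module l) := basis_coord (murphy_basis l) x i.
have c_lin (x : cell_module l) : c x = \sum_v x v * c [ffun w => (w == v)%:R].
  have {1}-> : x = \sum_v x v *: ([ffun w => (w == v)%:R] : cell_module l).
    apply/ffunP=> w; rewrite sum_ffunE (bigD1 w) //= big1 ?addr0 => [|v ne].
      by rewrite !ffunE eqxx [_ *: _]mulr1.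
    by rewrite !ffunE eq_sym (negPf ne) [_ *: _]mulr0.
  rewrite /c; elim/big_rec2: _ => [|v y1 y2 _ <-].
    by rewrite -(scale0r (0 : cell_module l)) basis_coordZ mul0r.
  by rewrite basis_coord_lin.
have [a aE] := dense (fun v => c [ffun w => (w == v)%:R]) (murphy l tl).
exists k, a; split=> //; exists (fun x => k * c x); split=> [|x].
  have -> : murphy l tl = murphy l (std_path i).
    by congr cell_act; apply: dpath_ext => j /iE.
  by rewrite /c basis_coord_basis eqxx mulr1.
by rewrite aE -c_lin.
Qed.

(** The element [dpath u s * f - c * dpath tl s] kills [dgen l], so multiplying by
    it after the upper segment of [u] gives a vector of the higher span. *)
Lemma murphy_act_projection (c : R) (f : dalg D s) u : is_Std0 nu u -> u s = l ->
  cell_act (murphy l u) f = c *: murphy l tl ->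
  span_paths gt_l (cell_act (murphy nu u) (incl n f) -
                   c *: murphy nu (path_comp s tl u)).
Proof.
move=> [_ un edges] us fE.
have [k [e eP]] := ideal_unit_exists (dsplit D s) (up_closed_gt (nu := l)).
have dE : dpath (path_comp s tl u) (n + s) = dseg s n u * incl n (dpath tl s).
  rewrite dpath_split; congr (_ * incl n _).
    apply: dseg_ext => j /andP[le_sj _]; rewrite /path_comp.
    case: (ltngtP j s) le_sj => // -> _; exact/esym.
  by apply: dpath_ext => j le_js; rewrite /path_comp le_js.
have -> : cell_act (murphy nu u) (incl n f) - c *: murphy nu (path_comp s tl u) =
    cell_act (dgen nu) (dseg s n u * incl n (- c *: dpath tl s + dpath u s * f)).
  rewrite incl_lin mulrDr -scalerAr cell_act_linr scaleNr addrC.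
  by rewrite /murphy dE dpath_split -cell_actM inclM mulrA.
rewrite -un; apply: (dseg_in_span (up_closed_gt (nu := l)) eP).
  by move=> j /andP[_ lt]; apply: edges.
rewrite us; apply/dgen_act_eq0.
by rewrite cell_act_linr cell_actM fE scaleNr addNr.
Qed.

Lemma gt_act_level x b : span_paths (nu := nu) gt_l x ->
  span_paths gt_l (cell_act x (incl n b)).
Proof.
have [k [e eP]] := ideal_unit_exists (dsplit D s) (up_closed_gt (nu := l)).
have [S0 SD SZ] := span_paths_subspace nu gt_l.
move: x; apply: lin_span_min => [|_ [t [[t0 tn edges] lt ->]]].
  split=> [|x y Sx Sy|c x Sx]; first by rewrite cell_act0l.
    by rewrite cell_actDl; apply: (SD).
  by rewrite cell_actZl; apply: (SZ).
rewrite -tn /murphy dpath_split -cell_actM -mulrA -inclM.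
apply: (dseg_in_span (up_closed_gt (nu := l)) eP).
  by move=> j /andP[_ lt_j]; apply: edges.
by apply: in_ideal_dm => //; apply: up_closed_gt.
Qed.

(** If [x] is in the span, then [k *: x] is [x * f] modulo the higher span, and
    [(x * f) * a = (x * a) * f].  Now [x * a] stays in the span of the paths with
    [l <= t s], which [f] maps to the span of [gt_or_tl]. *)
Lemma gt_or_tl_stable x (a : dalg D (n + s)) : rel_commutant D s _ a ->
  span_paths (nu := nu) gt_or_tl x -> span_paths gt_or_tl (cell_act x a).
Proof.
move=> ca Sx.
have [k [f [k0 [c [ck fE]]]]] := projection_exists.
have [ke [e eP]] := ideal_unit_exists (dsplit D s) (up_closed_ge (nu := l)).
have [G0 GD GZ] := span_paths_subspace nu gt_l.
have [S0 SD SZ] := span_paths_subspace nu gt_or_tl.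
have GS y : span_paths gt_l y -> span_paths (nu := nu) gt_or_tl y.
  move: y; apply: lin_span_min => // _ [t [St lt ->]].
  by apply: murphy_in_span => //; apply/orP; left.
have ge_ext y : span_paths gt_or_tl y ->
    span_paths (nu := nu) (fun t => (l <= t s)%O) y.
  move: y; apply: lin_span_min; first exact: span_paths_subspace.
  move=> _ [t [St /orP Qt ->]]; apply: murphy_in_span => //.
  by case: Qt => [/ltW //|/starts_tlP ->].
have image y : span_paths (fun t => (l <= t s)%O) y ->
    span_paths (nu := nu) gt_or_tl (cell_act y (incl n f)).
  move: y; apply: lin_span_min => [|_ [t [St le_t ->]]].
    split=> [|y z Sy Sz|d y Sy]; first by rewrite cell_act0l.
      by rewrite cell_actDl; apply: (SD).
    by rewrite cell_actZl; apply: (SZ).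
  have [lt|] := boolP (gt_l t).
    exact/GS/gt_act_level/murphy_in_span.
  rewrite /gt_l lt_neqAle le_t andbT negbK => /eqP ts.
  rewrite -[X in span_paths _ X](subrK
    (c (murphy l t) *: murphy nu (path_comp s tl t))).
  apply: (SD); first by apply/GS/murphy_act_projection.
  have [t0 tn edges] := St.
  apply/SZ/murphy_in_span.
    by apply: path_comp_Std0; split=> // j /andP[_ lt]; apply: edges.
  by apply/orP; right; apply/starts_tlP => j le_js; rewrite /path_comp le_js.
have id_mod y : span_paths gt_or_tl y ->
    span_paths (nu := nu) gt_l (k *: y - cell_act y (incl n f)).
  move: y; apply: lin_span_min => [|_ [t [St /orP[lt|tE] ->]]].
  - split=> [|y z Sy Sz|d y Sy]; first by rewrite cell_act0l scaler0 subr0.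
      by rewrite cell_actDl scalerDr opprD addrACA; apply: (GD).
    by rewrite cell_actZl scalerA mulrC -scalerA -scalerBr; apply: (GZ).
  - apply: subspaceB; first exact: span_paths_subspace.
      exact/GZ/murphy_in_span.
    exact/gt_act_level/murphy_in_span.
  have tE' := elimT (starts_tlP t) tE.
  have mE : murphy l t = murphy l tl by congr cell_act; apply: dpath_ext.
  have := murphy_act_projection St (tE' s (leqnn s)) (fE (murphy l t)).
  rewrite mE ck.
  have -> : murphy nu (path_comp s tl t) = murphy nu t.
    congr cell_act; apply: dpath_ext => j _; rewrite /path_comp.
    by case: leqP => // /tE'.
  by move=> /(GZ (-1)); rewrite scaleN1r opprB.
apply: (@span_paths_saturated _ _ _ _ _ k) => //.
  move=> t u tu; rewrite /gt_or_tl /gt_l tu ?leq_addl //; congr (_ || _).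
  apply: eq_forallb => j; rewrite tu //.
  by rewrite (leq_trans _ (leq_addl n s)) // -ltnS.
rewrite -cell_actZl -[k *: x](subrK (cell_act x (incl n f))) cell_actDl.
apply: (SD); first by apply/GS/gt_span_stable/id_mod.
rewrite -cell_actM -ca; last exact: incl_from_level.
rewrite cell_actM; apply: image.
exact: (commutant_span (up_closed_ge (nu := l)) eP ca (ge_ext _ Sx)).
Qed.

End Main.

Theorem lemma6p1 (R : idomainType) (D : diagram_algebras R) (s r : nat)
    (lt_sr : (s < r)%N) (nu : vertex D r) (l : vertex D s) (tl : path_fun D)
    (tl_max : maximal_Std0 l tl) :
  submodule (@cell_act _ _ _ nu) (rel_commutant D s r) (Delta_gt nu l)
  /\ submodule (@cell_act _ _ _ nu) (rel_commutant D s r)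
       (addsub (Delta_path nu l tl) (Delta_gt nu l)).
Proof.
have [n En] : exists n, r = (n + s)%N by exists (r - s)%N; rewrite subnK // ltnW.
subst r; have [tlS _] := tl_max; have tls : tl s = l by case: tlS.
subst l; split.
  have [S0 SD SZ] := span_paths_subspace nu (fun t => tl s < t s)%O.
  by split=> // x a ca Sx; apply: gt_span_stable.
have [S0 SD SZ] := span_paths_subspace nu
  (fun t => (tl s < t s)%O || [forall j : 'I_s.+1, t j == tl j]).
have E := addsub_spanE (nu := nu) tlS.
split=> [|x y /E Sx /E Sy|c x /E Sx|x a ca /E Sx]; apply/E.
- exact: S0.
- exact: SD.
- exact: SZ.
exact: gt_or_tl_stable.
Qed.
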